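(* There exist Gorenstein local rings $(R,\mathfrak m)$ with $\mathfrak m^4=0$ and $\operatorname{codim} R=6$ over which the following hold: (a) there exists a finitely generated $R$-module whose Betti sequence is constant and whose Bass sequence has exponential growth; (b) there exists a finitely generated $R$-module whose Betti sequence has exponential growth and whose Bass sequence is constant; (c) moreover, there exist finitely generated $R$-modules $M$, $N$ such that $$\operatorname{Ext}^i_R(M,N)=0\quad\text{for all } i>0\qquad\text{and}\qquad \operatorname{Ext}^i_R(N,M)\neq 0\quad\text{for all } i>0.$$
   Context: Local rings are commutative and Noetherian. For a local ring $(R,\mathfrak m,k)$ with residue field $k=R/\mathfrak m$ and a finitely generated $R$-module $M$, $\nu_R(M)$ denotes the minimal number of generators of $M$, and $\operatorname{codim} R=\nu_R(\mathfrak m)-\dim R$. The Betti numbers of $M$ are $\beta_i^R(M)=\nu_R(\operatorname{Ext}^i_R(M,k))$ and the Bass numbers of $M$ are $\mu^i_R(M)=\nu_R(\operatorname{Ext}^i_R(k,M))$, for $i\ge 0$. The Betti sequence is $\{\beta_i^R(M)\}_{i\ge 0}$ and the Bass sequence is $\{\mu^i_R(M)\}_{i\ge 0}$. A sequence $\{c_i\}_{i\ge 0}$ has exponential growth if there exist $a,b\in\mathbb R$ with $1<a\le b$ such that $a^i\le c_i\le b^i$ for all $i\gg 0$. *)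

(* Defs.v *)
From Stdlib Require Rdefinitions Raxioms Rpow_def.
From HB Require Import structures.
From mathcomp Require Import all_boot all_order all_algebra.
From mathcomp Require Import generic_quotient ring_quotient.
From mathcomp Require Import boolp classical_sets functions.
From mathcomp Require Import freeg.

Set Implicit Arguments.
Unset Strict Implicit.
Unset Printing Implicit Defensive.

Import Order.TTheory GRing.Theory Num.Theory.
Local Open Scope ring_scope.
Local Open Scope quotient_scope.
Local Open Scope classical_set_scope.

(* Submodules of [V] are the (decidable) predicates [submodClosed V] of the
   algebra library; every submodule is one, by classical logic. *)

Section Submodule.
Variables (R : comNzRingType) (V : lmodType R) (S : submodClosed V).

Record submod : Type := Submod { submod_val :> V; submod_valP : submod_val \in S }.
HB.instance Definition _ := [isSub for submod_val].
HB.instance Definition _ := [Choice of submod by <:].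
HB.instance Definition _ := [SubChoice_isSubLmodule of submod by <:].

End Submodule.

Section QuotientModule.
Variables (R : comNzRingType) (V : lmodType R) (S : submodClosed V).

(* [submodClosed V] records no closure under opposite, which the library quotient
   requires. *)
Definition submod_pred : V -> bool := fun x => x \in S.
Fact submod_pred_closed : zmod_closed submod_pred.
Proof. exact: (GRing.submod_closedB (submodClosedP S)). Qed.
HB.instance Definition _ :=
  GRing.isZmodClosed.Build V submod_pred submod_pred_closed.
Let zS : zmodClosed V := GRing.ZmodClosed.clone V submod_pred _.

Definition quotmod : Type := Quotient.quot zS.
HB.instance Definition _ := GRing.Zmodule.on quotmod.
HB.instance Definition _ := Quotient.on quotmod.

Definition quotmod_scale (a : R) : quotmod -> quotmod :=
  fun x => \pi_quotmod (a *: repr x).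

Fact quotmod_scale_pi a (x : V) :
  quotmod_scale a (\pi_quotmod x) = \pi_quotmod (a *: x).
Proof.
apply/eqP; rewrite /quotmod_scale -Quotient.idealrBE -scalerBr.
have : repr (\pi_quotmod x) - x \in submod_pred
  by rewrite Quotient.idealrBE reprK.
exact: (@rpredZ _ _ S).
Qed.

Fact quotmod_pi_surj (x : quotmod) : exists y, x = \pi_quotmod y.
Proof. by exists (repr x); rewrite reprK. Qed.

Fact quotmod_piD (x y : V) :
  \pi_quotmod (x + y) = \pi_quotmod x + \pi_quotmod y.
Proof. exact: (Quotient.pi_add zS x y). Qed.

Fact quotmod_scaleA a b x :
  quotmod_scale a (quotmod_scale b x) = quotmod_scale (a * b) x.
Proof.
by have [y ->] := quotmod_pi_surj x; rewrite !quotmod_scale_pi scalerA.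
Qed.

Fact quotmod_scale1 : left_id 1 quotmod_scale.
Proof.
by move=> x; have [y ->] := quotmod_pi_surj x; rewrite quotmod_scale_pi scale1r.
Qed.

Fact quotmod_scaleDr : right_distributive quotmod_scale +%R.
Proof.
move=> a x y; have [u ->] := quotmod_pi_surj x; have [v ->] := quotmod_pi_surj y.
by rewrite -quotmod_piD !quotmod_scale_pi scalerDr quotmod_piD.
Qed.

Fact quotmod_scaleDl x : {morph quotmod_scale^~ x : a b / a + b}.
Proof.
move=> a b; have [y ->] := quotmod_pi_surj x.
by rewrite !quotmod_scale_pi scalerDl quotmod_piD.
Qed.

HB.instance Definition _ := GRing.Zmodule_isLmodule.Build R quotmod
  quotmod_scaleA quotmod_scale1 quotmod_scaleDr quotmod_scaleDl.

End QuotientModule.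

Section Hom.
Variables (R : comNzRingType) (U V : lmodType R).

Definition hom : Type := {linear U -> V}.

Fact hom_ext (f g : {linear U -> V}) : f =1 g -> f = g.
Proof.
case: f g => [f cf] [g cg] /= /funext fg; subst g; congr GRing.Linear.Pack.
case: cf cg => [[f0] [f1]] [[g0] [g1]].
by congr GRing.Linear.Class;
  [congr GRing.isNmodMorphism.Axioms_ | congr GRing.isScalable.Axioms_];
  exact: Prop_irrelevance.
Qed.

HB.instance Definition _ := gen_eqMixin hom.
HB.instance Definition _ := gen_choiceMixin hom.

Definition hom_zero : hom := (\0 : U -> V).
Definition hom_opp (f : hom) : hom := (\- (f : U -> V)).
Definition hom_add (f g : hom) : hom := ((f : U -> V) \+ (g : U -> V)).
Definition hom_scale (a : R) (f : hom) : hom := (a \*: (f : U -> V)).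

Fact hom_addA : associative hom_add.
Proof. by move=> f g h; apply: hom_ext => x /=; rewrite addrA. Qed.
Fact hom_addC : commutative hom_add.
Proof. by move=> f g; apply: hom_ext => x /=; rewrite addrC. Qed.
Fact hom_add0 : left_id hom_zero hom_add.
Proof. by move=> f; apply: hom_ext => x /=; rewrite add0r. Qed.
Fact hom_addN : left_inverse hom_zero hom_opp hom_add.
Proof. by move=> f; apply: hom_ext => x /=; rewrite addNr. Qed.
HB.instance Definition _ :=
  GRing.isZmodule.Build hom hom_addA hom_addC hom_add0 hom_addN.

Fact hom_scaleA a b f : hom_scale a (hom_scale b f) = hom_scale (a * b) f.
Proof. by apply: hom_ext => x /=; rewrite scalerA. Qed.
Fact hom_scale1 : left_id 1 hom_scale.
Proof. by move=> f; apply: hom_ext => x /=; rewrite scale1r. Qed.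
Fact hom_scaleDr : right_distributive hom_scale +%R.
Proof. by move=> a f g; apply: hom_ext => x /=; rewrite scalerDr. Qed.
Fact hom_scaleDl f : {morph hom_scale^~ f : a b / a + b}.
Proof. by move=> a b; apply: hom_ext => x /=; rewrite scalerDl. Qed.
HB.instance Definition _ := GRing.Zmodule_isLmodule.Build R hom
  hom_scaleA hom_scale1 hom_scaleDr hom_scaleDl.

End Hom.

Section Resolution.
Variable R : comNzRingType.
Implicit Types M N P : lmodType R.

Definition surjective {A B : Type} (f : A -> B) := forall y, exists x, f x = y.

Definition exact_at (A B C : lmodType R) (f : A -> B) (g : B -> C) :=
  forall y, g y = 0 <-> exists x, f x = y.

Definition projective_module P := forall (A B : lmodType R)
  (g : {linear A -> B}) (h : {linear P -> B}), surjective g ->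
  exists l : {linear P -> A}, forall x, g (l x) = h x.

Record proj_resolution M := ProjResolution {
  res_mod : nat -> lmodType R;
  res_diff : forall i, {linear res_mod i.+1 -> res_mod i};
  res_aug : {linear res_mod 0 -> M};
  res_projective : forall i, projective_module (res_mod i);
  res_aug_surj : surjective res_aug;
  res_exact0 : exact_at (res_diff 0) res_aug;
  res_exact : forall i, exact_at (res_diff i.+1) (res_diff i)
}.

(* The standard resolution: cover [M] by the free module on its elements, cover
   the kernel in the same way, and so on. *)
Section Standard.

Definition free_cover M : lmodType R := {freeg M / R}.

Fact fglift_linear (K : choiceType) M (f : K -> M) : linear (fglift f).
Proof.
have fD := lift_is_additive f.
have f0 : fglift f 0 = 0 by rewrite -(subrr 0) fD subrr.
have fDD x y : fglift f (x + y) = fglift f x + fglift f y.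
  have fN z : fglift f (- z) = - fglift f z by rewrite -[- z]add0r fD f0 add0r.
  by rewrite -[y in LHS]opprK fD fN opprK.
have fS I (r : seq I) (F : I -> {freeg K / R}) :
    fglift f (\sum_(i <- r) F i) = \sum_(i <- r) fglift f (F i).
  by elim: r => [|i r IH]; rewrite ?big_nil // !big_cons fDD IH.
move=> a u v; rewrite fDD; congr (_ + _).
rewrite -{2}(freeg_sumE u) [a *: u]/(fgscale a u) /fgscale !fS scaler_sumr.
by apply: eq_bigr => k _; rewrite !liftU scalerA.
Qed.
HB.instance Definition _ (K : choiceType) M (f : K -> M) :=
  GRing.isLinear.Build R {freeg K / R} M *:%R (fglift f) (fglift_linear f).

Definition eval_cover M : {linear free_cover M -> M} := fglift (fun x : M => x).

Fact eval_cover_surj M : surjective (eval_cover M).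
Proof. by move=> x; exists << x >>; rewrite /eval_cover /= liftU scale1r. Qed.

Fact free_cover_projective M : projective_module (free_cover M).
Proof.
move=> A B g h gsurj.
pose s x := sval (cid (gsurj (h << x >>))).
have sP x : g (s x) = h << x >> by rewrite /s; case: cid.
exists (fglift s : {linear free_cover M -> A}) => u.
rewrite -[u]freeg_sumE !linear_sum; apply: eq_bigr => k _ /=.
rewrite liftU linearZ /= sP -linearZ /=; congr (h _).
by apply/eqP/freeg_eqP => x; rewrite coeffZ !coeffU mul1r.
Qed.

Definition kernel (A B : lmodType R) (f : {linear A -> B}) : A -> bool :=
  fun x => f x == 0.
Fact kernel_closed A B f : submod_closed (@kernel A B f).
Proof.
have kE x : (x \in kernel f) = (f x == 0) by [].
split=> [|a u v]; rewrite !kE ?linear0 // linearP => /eqP -> /eqP ->.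
by rewrite scaler0 addr0.
Qed.
HB.instance Definition _ A B f :=
  GRing.isSubmodClosed.Build R A (@kernel A B f) (@kernel_closed A B f).

Definition syzygy1 M : lmodType R :=
  submod (GRing.SubmodClosed.clone R _ (kernel (eval_cover M)) _).

Definition syzygy M (i : nat) : lmodType R := iter i syzygy1 M.

Definition std_diff M i :
    {linear free_cover (syzygy M i.+1) -> free_cover (syzygy M i)} :=
  (val : syzygy1 (syzygy M i) -> free_cover (syzygy M i))
    \o eval_cover (syzygy M i.+1).

Fact std_exact M i : exact_at (std_diff M i) (eval_cover (syzygy M i)).
Proof.
move=> y; split=> [y0|[x <-]]; last by apply/eqP; exact: (valP (eval_cover _ x)).
have yK : y \in kernel (eval_cover (syzygy M i)) by apply/eqP.
have [x xy] := eval_cover_surj (Submod yK : syzygy M i.+1).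
by exists x; rewrite /std_diff /= xy.
Qed.

Fact std_exactS M i : exact_at (std_diff M i.+1) (std_diff M i).
Proof.
move=> y; rewrite -std_exact /std_diff /=; split=> [y0|->]; last exact: (linear0 val).
apply: val_inj; rewrite -[RHS]/(val (0 : submod _)) (linear0 val). exact: y0.
Qed.

Definition std_resolution M : proj_resolution M := ProjResolution
  (fun i => @free_cover_projective (syzygy M i)) (@eval_cover_surj M)
  (@std_exact M 0) (@std_exactS M).

End Standard.

(* [Ext^i(M, N)]: the [i]-th cohomology of [Hom(P, N)], for [P] a projective
   resolution of [M]. *)
Section ExtOf.
Variables (M N : lmodType R) (P : proj_resolution M).

Definition cocycle i : hom (res_mod P i) N -> bool :=
  fun f => `[< forall x, f (res_diff P i x) = 0 >].

Definition coboundary i : hom (res_mod P i) N -> Prop :=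
  match i return hom (res_mod P i) N -> Prop with
  | 0 => fun f => f = 0
  | j.+1 => fun f =>
      exists g : hom (res_mod P j) N, forall x, f x = g (res_diff P j x)
  end.

Fact coboundary0 i : @coboundary i 0.
Proof. by case: i => [|j] //; exists 0. Qed.

Fact coboundaryP i a (f g : hom (res_mod P i) N) :
  coboundary f -> coboundary g -> coboundary (a *: f + g).
Proof.
case: i f g => [|j] f g /=; first by move=> -> ->; rewrite scaler0 addr0.
by move=> [f' ff'] [g' gg']; exists (a *: f' + g') => x /=; rewrite ff' gg'.
Qed.

Variable i : nat.

Fact cocycle_closed : submod_closed (@cocycle i).
Proof.
split=> [|a f g /asboolP f0 /asboolP g0]; apply/asboolP => x //=.
by rewrite f0 g0 scaler0 addr0.
Qed.
HB.instance Definition _ :=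
  GRing.isSubmodClosed.Build R (hom (res_mod P i) N) (@cocycle i)
    cocycle_closed.

Definition cocycles : lmodType R :=
  submod (GRing.SubmodClosed.clone R _ (@cocycle i) _).

Definition coboundary_in : cocycles -> bool :=
  fun z => `[< coboundary (val z) >].

Fact coboundary_in_closed : submod_closed coboundary_in.
Proof.
have cE z : (z \in coboundary_in) = `[< coboundary (val z) >] by [].
split=> [|a u v]; rewrite !cE.
  by apply/asboolP; rewrite (linear0 val); exact: coboundary0.
move=> /asboolP cu /asboolP cv; apply/asboolP; rewrite (linearP val).
exact: coboundaryP.
Qed.
HB.instance Definition _ :=
  GRing.isSubmodClosed.Build R cocycles coboundary_in coboundary_in_closed.

Definition ext_of : lmodType R :=
  quotmod (GRing.SubmodClosed.clone R _ coboundary_in _).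

End ExtOf.

Definition ext (i : nat) (M N : lmodType R) : lmodType R :=
  ext_of N (std_resolution M) i.

Definition zero_module M := forall x : M, x = 0.

End Resolution.

Section FinitelyGenerated.
Variable R : comNzRingType.

Definition generated_by (n : nat) (M : lmodType R) :=
  exists g : 'I_n -> M, forall x, exists c : 'I_n -> R, x = \sum_i c i *: g i.

Definition fin_gen (M : lmodType R) := exists n, generated_by n M.

(* By convention [0] if [M] is not finitely generated. *)
Definition num_gens (M : lmodType R) : nat :=
  xget 0%N [set n | generated_by n M /\
                    forall p, generated_by p M -> (n <= p)%N].

End FinitelyGenerated.

Section LocalRing.
Variable R : comNzRingType.

(* Ideals are the submodules of [R^o]. *)
Implicit Types I J m : submodClosed R^o.

Definition noetherian := forall I, fin_gen (submod I).

Definition maximal_ideal m :=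
  1 \notin m /\ forall I, {subset m <= I} -> 1 \notin I -> {subset I <= m}.

Definition local_ring m :=
  maximal_ideal m /\ forall m', maximal_ideal m' -> m' =i m.

Definition prime_ideal I := 1 \notin I /\ prime_idealr_closed (I : {pred R}).

Definition prime_chain (n : nat) := exists p : nat -> submodClosed R^o,
  (forall i, (i <= n)%N -> prime_ideal (p i)) /\
  (forall i, (i < n)%N -> {subset p i <= p i.+1} /\ ~ {subset p i.+1 <= p i}).

(* Length of the longest chain of primes; it exists for Noetherian local rings,
   and the convention is [0] otherwise. *)
Definition krull_dim : nat :=
  xget 0%N [set d | prime_chain d /\ forall n, prime_chain n -> (n <= d)%N].

Definition codim m : int := (num_gens (submod m))%:Z - krull_dim%:Z.

Definition ideal_prod (A B : set R) : set R :=
  [set x | exists n (a b : 'I_n -> R),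
     (forall i, A (a i) /\ B (b i)) /\ x = \sum_i a i * b i].

Definition ideal_pow (A : set R) (n : nat) : set R :=
  iter n (ideal_prod A) [set: R].

Definition injective_module (E : lmodType R) := forall (A B : lmodType R)
  (f : {linear A -> B}) (g : {linear A -> E}), injective f ->
  exists h : {linear B -> E}, forall x, h (f x) = g x.

(* [M] has an injective resolution of length at most [n]. *)
Fixpoint inj_dim_le (n : nat) (M : lmodType R) : Prop :=
  match n with
  | 0 => injective_module M
  | p.+1 => exists (E C : lmodType R) (f : {linear M -> E}) (g : {linear E -> C}),
      [/\ injective_module E, injective f, exact_at f g, surjective g
        & inj_dim_le p C]
  end.

Definition gorenstein_local m :=
  [/\ noetherian, local_ring m & exists n, inj_dim_le n R^o].

Definition residue_field m : lmodType R := quotmod m.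

Definition betti m (M : lmodType R) (i : nat) : nat :=
  num_gens (ext i M (residue_field m)).

Definition bass m (M : lmodType R) (i : nat) : nat :=
  num_gens (ext i (residue_field m) M).

End LocalRing.

Definition constant_seq (c : nat -> nat) := exists b, forall i, c i = b.

Definition exponential_growth (c : nat -> nat) :=
  exists a b : Rdefinitions.R,
    [/\ Rdefinitions.Rlt Rdefinitions.R1 a, Rdefinitions.Rle a b &
      exists i0, forall i, (i0 <= i)%N ->
        Rdefinitions.Rle (Rpow_def.pow a i) (Raxioms.INR (c i)) /\
        Rdefinitions.Rle (Raxioms.INR (c i)) (Rpow_def.pow b i)].

(* Main.v *)
(** Let [T] be a symmetric trilinear form on [V = F^6]. The graded space
    [A = F + V + V* + F], with product [V x V -> V*] given by [T] and
    [V x V* -> F] by evaluation, is a local algebra, and it is self-injective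
    because its socle coordinate is a perfect pairing. For the form chosen here
    the matrices [D_l = (x1, l x3; x4, x2)] satisfy [D_l D_(2l) = 0], with
    exactness at [D_l] unless [l = 1]. Hence [M = coker D_2] has the free
    resolution [D_2, D_4, D_8, ...], and the kernel [K] of the transpose of
    [D_2] is resolved by rank 2 free, hence injective, modules. The failure of
    exactness at [l = 1] gives [M] an extra socle element and [K] an extra
    generator. This makes the other two sequences grow: [x5] and [x6] span a
    square-zero subring [S = F + F x5 + F x6], which is a retract of [A], and
    when the residue field [k] splits off both [X] and [Y] over [S] (compatibly
    with [A]-linear maps [X -> k] and [k -> Y]) the space [Ext_S^i(k, k)], of
    dimension [2^i], embeds in [Ext_A^i(X, Y)]. The same mechanism gives the
    nonvanishing in (c), for [N = F[t]/(t^2)] with [x1, x2] acting as [t], and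
    [D_l] tensored with [N] is [t] times the identity. *)

Require Import Defs.
From Stdlib Require Reals Lra.
From HB Require Import structures.
From mathcomp Require Import all_boot all_order all_algebra.
From mathcomp Require Import generic_quotient ring_quotient ring lra.
From mathcomp Require Import boolp classical_sets functions.
Set Implicit Arguments.
Unset Strict Implicit.
Unset Printing Implicit Defensive.
Import Order.TTheory GRing.Theory Num.Theory.
Local Open Scope ring_scope.
Local Open Scope quotient_scope.
Local Open Scope classical_set_scope.

(** * Modules and generation *)

Section Modules.
Variable R : comNzRingType.

Lemma quotmod_eqP (V : lmodType R) (S : submodClosed V) (x y : V) :
  (\pi_(quotmod S) x = \pi_(quotmod S) y) <-> x - y \in S.
Proof.
have -> : (x - y \in S) = (\pi_(quotmod S) x == \pi_(quotmod S) y).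
  by rewrite -Quotient.idealrBE.
by split=> /eqP.
Qed.

Lemma quotmod_piP (V : lmodType R) (S : submodClosed V) :
  linear (\pi_(quotmod S) : V -> quotmod S).
Proof.
by move=> a x y; rewrite quotmod_piD -quotmod_scale_pi.
Qed.

Definition quotmod_pi (V : lmodType R) (S : submodClosed V) (x : V) : quotmod S :=
  \pi_(quotmod S) x.
HB.instance Definition _ (V : lmodType R) (S : submodClosed V) :=
  GRing.isLinear.Build R V (quotmod S) *:%R (@quotmod_pi V S) (@quotmod_piP V S).

Lemma quotmod_lift (V W : lmodType R) (S : submodClosed V) (f : {linear V -> W}) :
  (forall x, x \in S -> f x = 0) ->
  exists g : {linear quotmod S -> W}, forall x, g (quotmod_pi S x) = f x.
Proof.
move=> fS; pose g (z : quotmod S) := f (repr z).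
have gE x : g (quotmod_pi S x) = f x.
  apply/eqP; rewrite -subr_eq0 -linearB; apply/eqP/fS/quotmod_eqP.
  by rewrite reprK.
have glin : linear g.
  move=> a u v; have [x ->] := quotmod_pi_surj u; have [y ->] := quotmod_pi_surj v.
  by rewrite -/(quotmod_pi S x) -/(quotmod_pi S y) -linearP !gE linearP.
pose G : {linear quotmod S -> W} :=
  HB.pack g (GRing.isLinear.Build R (quotmod S) W *:%R g glin).
by exists G.
Qed.

Lemma quotmod_pi_eq0 (V : lmodType R) (S : submodClosed V) (x : V) :
  (quotmod_pi S x = 0) <-> x \in S.
Proof. by rewrite -(linear0 (@quotmod_pi V S)) quotmod_eqP subr0. Qed.

Lemma submod_val_comb (V : lmodType R) (S : submodClosed V) n (c : 'I_n -> R)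
    (y : 'I_n -> submod S) (x : submod S) :
  val (x - \sum_k c k *: y k) = val x - \sum_k c k *: val (y k).
Proof.
by rewrite (linearB val) (linear_sum val).
Qed.

Definition lin_image (A B : lmodType R) (f : {linear A -> B}) : B -> bool :=
  fun y => `[< exists x, f x = y >].

Lemma lin_imageP (A B : lmodType R) (f : {linear A -> B}) y :
  reflect (exists x, f x = y) (y \in lin_image f).
Proof. exact: asboolP. Qed.

Lemma lin_image_closed (A B : lmodType R) (f : {linear A -> B}) :
  submod_closed (lin_image f).
Proof.
split=> [|a _ _ /lin_imageP[x <-] /lin_imageP[y <-]]; apply/lin_imageP.
  by exists 0; rewrite linear0.
by exists (a *: x + y); rewrite linearP.
Qed.
HB.instance Definition _ A B f :=
  GRing.isSubmodClosed.Build R B (@lin_image A B f) (@lin_image_closed A B f).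

(** Preimages under [f] are unique, so any pointwise choice of them is linear. *)
Lemma factor_through_inj (P A E : lmodType R) (f : {linear A -> E})
    (h : {linear P -> E}) : injective f -> (forall x, exists y, f y = h x) ->
  exists g : {linear P -> A}, forall x, f (g x) = h x.
Proof.
move=> finj /choice[g gE].
have glin : linear g by move=> a u v; apply: finj; rewrite linearP !gE linearP.
pose G : {linear P -> A} := HB.pack g (GRing.isLinear.Build R P A *:%R g glin).
by exists G.
Qed.

Lemma factor_through_surj (P A E : lmodType R) (f : {linear P -> A})
    (h : {linear P -> E}) : surjective f -> (forall x, f x = 0 -> h x = 0) ->
  exists g : {linear A -> E}, forall x, g (f x) = h x.
Proof.
move=> fsurj fh; pose s y := sval (cid (fsurj y)).
have sP y : f (s y) = y by rewrite /s; case: cid.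
have hE x : h (s (f x)) = h x.
  apply/eqP; rewrite -subr_eq0 -linearB; apply/eqP/fh.
  by rewrite linearB sP subrr.
have glin : linear (h \o s).
  move=> a u v /=; rewrite -[u in LHS]sP -[v in LHS]sP -linearP hE.
  by rewrite linearP.
pose G : {linear A -> E} :=
  HB.pack (h \o s) (GRing.isLinear.Build R A E *:%R (h \o s) glin).
by exists G => x; apply: hE.
Qed.

(** Projectivity is stated for surjections, so both maps are first restricted to the image of [g],
    which contains that of [h]. *)
Lemma projective_lift (P A B : lmodType R) (g : {linear A -> B})
    (h : {linear P -> B}) : projective_module P ->
    (forall x, exists y, g y = h x) ->
  exists l : {linear P -> A}, forall x, g (l x) = h x.
Proof.
move=> projP gh; pose S := GRing.SubmodClosed.clone R _ (lin_image g) _.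
have [g' g'E] : exists g' : {linear A -> submod S}, forall x, val (g' x) = g x.
  apply: (@factor_through_inj A (submod S) B (val : submod S -> B)).
    exact: val_inj.
  move=> x; have gx : g x \in S by apply/lin_imageP; exists x.
  by exists (Submod gx).
have [h' h'E] : exists h' : {linear P -> submod S}, forall x, val (h' x) = h x.
  apply: (@factor_through_inj P (submod S) B (val : submod S -> B)).
    exact: val_inj.
  move=> x; have hx : h x \in S by apply/lin_imageP; apply: gh.
  by exists (Submod hx).
have g'surj : surjective g'.
  move=> [y yS]; have /lin_imageP[x gx] := yS; exists x.
  by apply: val_inj; rewrite g'E gx.
have [l lE] := projP _ _ g' h' g'surj.
by exists l => x; rewrite -g'E lE h'E.
Qed.

End Modules.

Section Generation.
Variable R : comNzRingType.

Lemma generated_by0 (M : lmodType R) : generated_by 0 M <-> zero_module M.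
Proof.
split=> [[g gP] x|M0]; first by have [c ->] := gP x; rewrite big_ord0.
by exists (fun=> 0) => x; exists (fun=> 0); rewrite big_ord0; apply: M0.
Qed.

Lemma num_gensP (M : lmodType R) n : generated_by n M ->
  generated_by (num_gens M) M /\ forall p, generated_by p M -> (num_gens M <= p)%N.
Proof.
move=> Mn; rewrite /num_gens; case: xgetP => [k -> //|none].
have ex : exists n, `[< generated_by n M >] by exists n; apply/asboolP.
have [k /asboolP Mk kmin] := ex_minnP ex.
by case: (none k); split=> // p Mp; apply/kmin/asboolP.
Qed.

(* Generation of the quotient [Z / B] expressed on representatives. *)
Definition gen_mod (V : lmodType R) n (Z B : V -> Prop) :=
  exists z : 'I_n -> V, (forall k, Z (z k)) /\
    forall f, Z f -> exists c : 'I_n -> R, B (f - \sum_k c k *: z k).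

(** Generators are carried along a linear correspondence instead of a map: a connecting homomorphism
    is defined only up to coboundaries and is most easily given as a relation. Totality in both
    directions and compatibility from [B] to [B'] suffice. *)
Lemma gen_mod_corr (V W : lmodType R) n (Z B : V -> Prop) (Z' B' : W -> Prop)
    (rho : V -> W -> Prop) :
    (forall a f g f' g', rho f f' -> rho g g' -> rho (a *: f + g) (a *: f' + g')) ->
    (forall f, Z f -> exists2 f', Z' f' & rho f f') ->
    (forall f', Z' f' -> exists2 f, Z f & rho f f') ->
    (forall f f', rho f f' -> B f -> B' f') ->
  gen_mod n Z B -> gen_mod n Z' B'.
Proof.
move=> rholin ZZ' Z'Z BB' [z [zZ zgen]].
have /choice[z' z'P] k : exists f', Z' f' /\ rho (z k) f'.
  by have [f' ? ?] := ZZ' _ (zZ k); exists f'.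
exists z'; split=> [k|f' f'Z]; first by case: (z'P k).
have [f fZ ff'] := Z'Z _ f'Z; have [c fc] := zgen f fZ.
exists c; apply: BB' fc.
(* The combination [- f + f] of one related pair; linearity by itself provides no related pair. *)
have r0 : rho 0 0 by have := rholin (-1) _ _ _ _ ff' ff'; rewrite !scaleN1r !addNr.
have rN u v : rho u v -> rho (- u) (- v).
  by move=> uv; have := rholin (-1) _ _ _ _ uv r0; rewrite !scaleN1r !addr0.
have rD u v u' v' : rho u v -> rho u' v' -> rho (u + u') (v + v').
  by move=> uv uv'; have := rholin 1 _ _ _ _ uv uv'; rewrite !scale1r.
apply: rD => //; apply: rN.
elim/big_rec2: _ => // k u v _ vu.
by apply: rholin => //; case: (z'P k).
Qed.

(** Strips the subtype and the quotient from [ext_of], so that later arguments deal with plain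
    homomorphisms. *)
Lemma gen_extP (M N : lmodType R) (P : proj_resolution M) i n :
  generated_by n (ext_of N P i) <->
  gen_mod n (fun f => f \in @cocycle R M N P i) (@coboundary R M N P i).
Proof.
set S := GRing.SubmodClosed.clone R _ (@coboundary_in R M N P i) _.
have inS z : (z \in S) = `[< coboundary (val z) >] by [].
split=> [[g gP]|[z [zZ zP]]].
  have /choice[y gy] k : exists y : cocycles N P i, g k = quotmod_pi S y.
    by have [y ->] := quotmod_pi_surj (g k); exists y.
  exists (fun k => val (y k)); split=> [k|f fZ]; first exact: valP.
  have [c fc] := gP (quotmod_pi S (Submod fZ : cocycles N P i)); exists c.
  have : (Submod fZ : cocycles N P i) - \sum_k c k *: y k \in S.
    apply/quotmod_pi_eq0; rewrite linearB /= fc linear_sum; apply/eqP.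
    rewrite subr_eq0; apply/eqP/eq_bigr => k _.
    by rewrite gy linearZ.
  by rewrite inS => /asboolP; rewrite submod_val_comb.
exists (fun k => quotmod_pi S (Submod (zZ k) : cocycles N P i)) => x.
have [[f fZ] ->] := quotmod_pi_surj x; have [c fc] := zP f fZ; exists c.
rewrite -/(quotmod_pi S _); apply/eqP; rewrite -subr_eq0.
under eq_bigr do rewrite -linearZ.
rewrite -linear_sum -linearB; apply/eqP/quotmod_pi_eq0; rewrite inS.
by apply/asboolP; rewrite submod_val_comb.
Qed.

End Generation.

Definition hom_comp (R : comNzRingType) (A B C : lmodType R)
  (g : {linear B -> C}) (f : {linear A -> B}) : Defs.hom A C := g \o f.

(** * Independence of the resolution and dimension shifting *)

Section Comparison.
Variables (R : comNzRingType) (M : lmodType R).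
Implicit Types P Q : proj_resolution M.

(** The augmentation plays the role of the differential leaving degree 0, so that degree 0 needs no
    separate treatment in the lifting steps. *)
Definition is_cycle P i : res_mod P i -> Prop :=
  match i with
  | 0 => fun x => res_aug P x = 0
  | j.+1 => fun x => res_diff P j x = 0
  end.

Lemma cycleP P i (y : res_mod P i) : is_cycle y <-> exists x, res_diff P i x = y.
Proof. by case: i y => [|i] y; [apply: res_exact0 | apply: res_exact]. Qed.

Lemma cocycleP (N : lmodType R) P i (f : Defs.hom (res_mod P i) N) :
  reflect (forall x, f (res_diff P i x) = 0) (f \in @cocycle R M N P i).
Proof. exact: asboolP. Qed.

Lemma cycle_diff P i (x : res_mod P i.+1) : is_cycle (res_diff P i x).
Proof. by apply/cycleP; exists x. Qed.

Definition preserves_cycles P Q i (phi : {linear res_mod P i -> res_mod Q i}) :=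
  forall x, is_cycle x -> is_cycle (phi x).

Lemma lift_step P Q i (phi : {linear res_mod P i -> res_mod Q i}) :
    preserves_cycles phi ->
  exists psi : {linear res_mod P i.+1 -> res_mod Q i.+1},
    forall x, res_diff Q i (psi x) = phi (res_diff P i x).
Proof.
move=> phic; pose h : {linear _ -> _} := phi \o res_diff P i.
apply: (@projective_lift _ _ _ _ (res_diff Q i) h (@res_projective _ _ P i.+1)).
by move=> x; apply/cycleP/phic/cycle_diff.
Qed.

Lemma lift_step_cycles P Q i (phi : {linear res_mod P i -> res_mod Q i})
    (psi : {linear res_mod P i.+1 -> res_mod Q i.+1}) :
    (forall x, res_diff Q i (psi x) = phi (res_diff P i x)) ->
  preserves_cycles psi.
Proof. by move=> psiE x /= x0; rewrite psiE x0 linear0. Qed.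

Lemma lift_base P Q : exists phi : {linear res_mod P 0 -> res_mod Q 0},
  forall x, res_aug Q (phi x) = res_aug P x.
Proof.
apply: (@projective_lift _ _ _ _ (res_aug Q) (res_aug P)).
  exact: res_projective.
by move=> x; apply: res_aug_surj.
Qed.

Lemma comparison_map P Q :
  exists phi : forall i, {linear res_mod P i -> res_mod Q i},
    (forall x, res_aug Q (phi 0 x) = res_aug P x) /\
    forall i x, res_diff Q i (phi i.+1 x) = phi i (res_diff P i x).
Proof.
have [phi0 phi0E] := lift_base P Q.
have phi0c : preserves_cycles phi0 by move=> x /= x0; rewrite phi0E.
(* The recursion carries the preservation of cycles along, since each lift needs it for the
   preceding map. *)
pose fix phi i : {f : {linear res_mod P i -> res_mod Q i} | preserves_cycles f} :=
  match i with
  | 0 => exist _ phi0 phi0c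
  | j.+1 => let: exist psi psiE := cid (lift_step (svalP (phi j))) in
            exist _ psi (lift_step_cycles psiE)
  end.
exists (fun i => sval (phi i)); split=> [//|i x] /=.
by case: cid.
Qed.

(** A chain endomorphism over the identity of [M] is homotopic to the identity:
    [theta - 1 = d h + g d]. A cocycle [f] kills [f d h], and [f g] is the cochain that bounds the
    rest. *)
Lemma comparison_homotopy P (theta : forall i, {linear res_mod P i -> res_mod P i})
    (N : lmodType R) i (f : Defs.hom (res_mod P i) N) :
    (forall x, res_aug P (theta 0 x) = res_aug P x) ->
    (forall i x, res_diff P i (theta i.+1 x) = theta i (res_diff P i x)) ->
  f \in @cocycle R M N P i ->
  @coboundary R M N P i ((hom_comp f (theta i)) - f).
Proof.
move=> theta0 thetaS.
(* Two consecutive components of the homotopy are enough in each degree, so the previous one is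
   merely asserted to exist and no coherent family is built. *)
have H j : exists h : {linear res_mod P j -> res_mod P j.+1},
    match j return {linear res_mod P j -> res_mod P j.+1} -> Prop with
    | 0 => fun h => forall x, theta 0 x - x = res_diff P 0 (h x)
    | k.+1 => fun h => exists g : {linear res_mod P k -> res_mod P k.+1},
        forall x, theta k.+1 x - x = res_diff P k.+1 (h x) + g (res_diff P k x)
    end h.
  elim: j => [|j [g gE]].
    pose e : {linear res_mod P 0 -> res_mod P 0} := theta 0 \- idfun.
    have [|h hE] := @projective_lift _ _ _ _ (res_diff P 0) e (@res_projective _ _ P 0).
      by move=> x; apply/cycleP; rewrite /= linearB theta0 subrr.
    by exists h => x; rewrite hE.
  pose e : {linear res_mod P j.+1 -> res_mod P j.+1} :=
    (theta j.+1 \- idfun) \- (g \o res_diff P j).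
  have [|h hE] := @projective_lift _ _ _ _ (res_diff P j.+1) e (@res_projective _ _ P j.+1).
    move=> x; apply/cycleP; rewrite /= !linearB /= thetaS.
    case: j g gE {e} x => [|j] g gE x.
      by rewrite -gE subrr.
    have [k kE] := gE; rewrite kE.
    have -> : res_diff P j (res_diff P j.+1 x) = 0 by apply/res_exact; exists x.
    by rewrite linear0 addr0 subrr.
  by exists h, g => x; rewrite hE /= subrK.
have [h hE] := H i => /cocycleP f0.
case: i f f0 h hE => [|i] f f0 h hE.
  apply: hom_ext => x /=; rewrite -linearB hE f0 //.
have [g gE] := hE; exists (hom_comp f g) => x /=.
by rewrite -linearB gE linearD f0 add0r.
Qed.

Lemma coboundary_comp P Q (N : lmodType R) i
    (phi : forall i, {linear res_mod P i -> res_mod Q i})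
    (f : Defs.hom (res_mod Q i) N) :
    (forall i x, res_diff Q i (phi i.+1 x) = phi i (res_diff P i x)) ->
  @coboundary R M N Q i f -> @coboundary R M N P i (hom_comp f (phi i)).
Proof.
move=> phiS; case: i f => [|i] f /=.
  by move=> ->; apply: hom_ext => x /=.
by case=> g gE; exists (hom_comp g (phi i)) => x /=; rewrite gE phiS.
Qed.

Lemma ext_generated_resolution (N : lmodType R) P Q i n :
  generated_by n (ext_of N P i) -> generated_by n (ext_of N Q i).
Proof.
rewrite !gen_extP.
have [phi [phi0 phiS]] := comparison_map Q P.
have [psi [psi0 psiS]] := comparison_map P Q.
(* A cocycle on [P] corresponds to every cochain on [Q] that differs from its pullback along [phi]
   by a coboundary; [psi] and the homotopy show that each cocycle on [Q] is reached. *)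
apply: (@gen_mod_corr R (Defs.hom (res_mod P i) N) (Defs.hom (res_mod Q i) N) n _ _ _ _
  (fun f f' => @coboundary R M N Q i (f' - (hom_comp f (phi i))))).
- move=> a f g f' g' ff' gg'; have := @coboundaryP _ _ _ _ _ a _ _ ff' gg'.
  congr coboundary; apply: hom_ext => x /=.
  by rewrite scalerBr opprD addrACA.
- move=> f /cocycleP f0; exists (hom_comp f (phi i)).
    by apply/cocycleP => x /=; rewrite -phiS f0.
  by rewrite subrr; apply: coboundary0.
- move=> f' f'0; exists (hom_comp f' (psi i)).
    by apply/cocycleP => x /=; rewrite -psiS (elimT (cocycleP _) f'0).
  pose theta j : {linear res_mod Q j -> res_mod Q j} := psi j \o phi j.
  have theta0 x : res_aug Q (theta 0 x) = res_aug Q x by rewrite /= psi0 phi0.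
  have thetaS j x : res_diff Q j (theta j.+1 x) = theta j (res_diff Q j x).
    by rewrite /= psiS phiS.
  have := comparison_homotopy theta0 thetaS f'0.
  move=> /(@coboundaryP _ _ _ _ _ (-1) _ 0) /(_ (@coboundary0 _ _ _ _ _)).
  by congr coboundary; apply: hom_ext => x /=; rewrite scaleN1r opprB addr0.
- move=> f f' ff' /(coboundary_comp phiS) f0.
  have := @coboundaryP _ _ _ _ _ 1 _ _ ff' f0; congr coboundary.
  by rewrite scale1r subrK.
Qed.

End Comparison.

(** * Dimension shifting in the second argument along a short exact sequence *)

Section DimensionShift.
Variables (R : comNzRingType) (X A E B : lmodType R) (P : proj_resolution X).
Variables (iota : {linear A -> E}) (pi : {linear E -> B}).
Hypotheses (iota_inj : injective iota) (pi_surj : surjective pi)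
  (iota_pi : exact_at iota pi).

(** A cocycle factors through the image of the differential, and injectivity of [E] extends it from
    there to the whole module. *)
Lemma injective_cocycle i (f : Defs.hom (res_mod P i.+1) E) : injective_module E ->
  f \in @cocycle R X E P i.+1 -> coboundary f.
Proof.
move=> injE /cocycleP f0; pose d := res_diff P i.
pose S := GRing.SubmodClosed.clone R _ (lin_image d) _.
have [d' d'E] : exists d' : {linear res_mod P i.+1 -> submod S},
    forall x, val (d' x) = d x.
  apply: (@factor_through_inj _ _ (submod S) _ (val : submod S -> _)).
    exact: val_inj.
  move=> x; have dx : d x \in S by apply/lin_imageP; exists x.
  by exists (Submod dx).
have [||g gE] := @factor_through_surj _ _ _ _ d' f.
- move=> [y yS]; have /lin_imageP[x dx] := yS; exists x.
  by apply: val_inj; rewrite d'E dx.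
- move=> x /(congr1 val); rewrite d'E => dx0.
  have /res_exact[y <-] : d x = 0 by rewrite dx0 (linear0 val).
  exact: f0.
have [|h hE] := injE (submod S) (res_mod P i) (val : submod S -> _) g.
- exact: val_inj.
by exists h => x; rewrite -gE -hE; congr (h _); apply: d'E.
Qed.

Variable i : nat.
(** In positive degree [Ei] follows from injectivity of [E]. In degree 0 it says that Hom(X, E) ->
    Hom(X, B) vanishes, which makes the connecting map Hom(X, B) -> Ext^1(X, A) injective. *)
Hypotheses
  (Ei : forall f : Defs.hom (res_mod P i) E, f \in @cocycle R X E P i ->
          @coboundary R X B P i (hom_comp pi f))
  (EiS : forall f : Defs.hom (res_mod P i.+1) E, f \in @cocycle R X E P i.+1 ->
           coboundary f).

(** The graph of the connecting homomorphism: lift [f] to [E], then apply the differential. *)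
Let shift (f : Defs.hom (res_mod P i) B) (f' : Defs.hom (res_mod P i.+1) A) :=
  exists F : Defs.hom (res_mod P i) E,
    (forall x, pi (F x) = f x) /\ forall x, F (res_diff P i x) = iota (f' x).

Let shift_linear a f g f' g' :
  shift f f' -> shift g g' -> shift (a *: f + g) (a *: f' + g').
Proof.
move=> [F [Ff Ff']] [G [Gg Gg']]; exists (a *: F + G); split=> x /=.
  by rewrite linearP Ff Gg.
by rewrite Ff' Gg' linearP.
Qed.

Let pi_iota x : pi (iota x) = 0. Proof. by apply/iota_pi; exists x. Qed.

Let shiftl (f : Defs.hom (res_mod P i) B) : f \in @cocycle R X B P i ->
  exists2 f', f' \in @cocycle R X A P i.+1 & shift f f'.
Proof.
move=> /cocycleP f0.
have [F FE] := @res_projective _ _ P i _ _ pi f pi_surj.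
pose Fd : {linear _ -> _} := F \o res_diff P i.
have [|f' f'E] := @factor_through_inj _ _ _ _ iota Fd iota_inj.
  by move=> x; apply/iota_pi; rewrite /= FE f0.
exists f'; last by exists F; split=> // x; rewrite f'E.
apply/cocycleP => x; apply: iota_inj; rewrite f'E linear0 /=.
have -> : res_diff P i (res_diff P i.+1 x) = 0 by apply/res_exact; exists x.
by rewrite linear0.
Qed.

Let shiftr (f' : Defs.hom (res_mod P i.+1) A) : f' \in @cocycle R X A P i.+1 ->
  exists2 f, f \in @cocycle R X B P i & shift f f'.
Proof.
move=> /cocycleP f'0.
have [|F FE] := EiS (f := hom_comp iota f').
  by apply/cocycleP => x /=; rewrite f'0 linear0.
exists (hom_comp pi F).
  by apply/cocycleP => x /=; rewrite -FE /= pi_iota.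
by exists F; split=> // x; rewrite -FE.
Qed.

Let shift_coboundary f f' : shift f f' -> coboundary f -> coboundary f'.
Proof.
move=> [F [Ff Ff']] f0.
(* It suffices to change the lift [F] so that it takes values in [A], keeping its composite with the
   differential. *)
suff [G [GF Gd]] : exists G : Defs.hom (res_mod P i) E,
    (forall x, pi (G x) = 0) /\ forall x, G (res_diff P i x) = iota (f' x).
  have [|g gE] := @factor_through_inj _ _ _ _ iota G iota_inj.
    by move=> x; apply/iota_pi.
  by exists g => x; apply: iota_inj; rewrite gE Gd.
case: i f f' F Ff Ff' f0 => [|j] f f' F Ff Ff' /=.
  by move=> f0; exists F; split=> // x; rewrite Ff f0.
case=> k kE; have [l lE] := @res_projective _ _ P j _ _ pi k pi_surj.
exists (F - (hom_comp l (res_diff P j))); split=> x /=.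
  by rewrite linearB lE Ff kE subrr.
have -> : res_diff P j (res_diff P j.+1 x) = 0 by apply/res_exact; exists x.
by rewrite linear0 subr0.
Qed.

Let shift_coboundary_inv f f' : shift f f' -> coboundary f' -> coboundary f.
Proof.
move=> [F [Ff Ff']] [g gE].
have /Ei : F - (hom_comp iota g) \in @cocycle R X E P i.
  by apply/cocycleP => x /=; rewrite Ff' gE subrr.
congr coboundary; apply: hom_ext => x /=.
by rewrite linearB pi_iota Ff subr0.
Qed.

Lemma ext_shift n :
  generated_by n (ext_of B P i) <-> generated_by n (ext_of A P i.+1).
Proof.
rewrite !gen_extP; split.
  exact: (gen_mod_corr shift_linear shiftl shiftr shift_coboundary).
apply: (@gen_mod_corr R (Defs.hom (res_mod P i.+1) A) (Defs.hom (res_mod P i) B)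
  n _ _ _ _ (fun f' f => shift f f')).
- by move=> a f g f' g'; apply: shift_linear.
- exact: shiftr.
- exact: shiftl.
- by move=> f f'; apply: shift_coboundary_inv.
Qed.

End DimensionShift.

(** * The algebra *)

Section CubicAlgebra.
Variable F : realFieldType.

Definition vec : Type := (F * F * F * F * F * F)%type.

(* The polarization [V x V -> V*] of the cubic form
   [X1 X2 X6 + (X1 - 2 X2) X3 X5 + (X1 - X2) (X4 X5 + X4^2 / 2) + X3^3 / 6
   - X4^3 / 3]. *)
Definition cubic_polar (u v : vec) : vec :=
  let: (u1, u2, u3, u4, u5, u6) := u in let: (v1, v2, v3, v4, v5, v6) := v in
  (u2 * v6 + u6 * v2 + (u3 * v5 + u5 * v3) + (u4 * v5 + u5 * v4 + u4 * v4),
   u1 * v6 + u6 * v1 - 2 * (u3 * v5 + u5 * v3) - (u4 * v5 + u5 * v4 + u4 * v4),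
   (u1 - 2 * u2) * v5 + u5 * (v1 - 2 * v2) + u3 * v3,
   (u1 - u2) * (v4 + v5) + (u4 + u5) * (v1 - v2) - 2 * (u4 * v4),
   (u1 - 2 * u2) * v3 + u3 * (v1 - 2 * v2) + (u1 - u2) * v4 + u4 * (v1 - v2),
   u1 * v2 + u2 * v1).

Definition dot (u v : vec) : F :=
  let: (u1, u2, u3, u4, u5, u6) := u in let: (v1, v2, v3, v4, v5, v6) := v in
  u1 * v1 + u2 * v2 + u3 * v3 + u4 * v4 + u5 * v5 + u6 * v6.

Definition vscale (a : F) (u : vec) : vec :=
  let: (u1, u2, u3, u4, u5, u6) := u in
  (a * u1, a * u2, a * u3, a * u4, a * u5, a * u6).

Definition vadd (u v : vec) : vec :=
  let: (u1, u2, u3, u4, u5, u6) := u in let: (v1, v2, v3, v4, v5, v6) := v in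
  (u1 + v1, u2 + v2, u3 + v3, u4 + v4, u5 + v5, u6 + v6).

Definition alg : Type := (F * vec * vec * F)%type.

HB.instance Definition _ := Choice.on alg.

Definition alg_add (x y : alg) : alg :=
  let: (x0, xv, xw, xz) := x in let: (y0, yv, yw, yz) := y in
  (x0 + y0, vadd xv yv, vadd xw yw, xz + yz).

Definition alg_opp (x : alg) : alg :=
  let: (x0, xv, xw, xz) := x in (- x0, vscale (-1) xv, vscale (-1) xw, - xz).

Definition alg_mul (x y : alg) : alg :=
  let: (x0, xv, xw, xz) := x in let: (y0, yv, yw, yz) := y in
  (x0 * y0, vadd (vscale x0 yv) (vscale y0 xv),
   vadd (vadd (vscale x0 yw) (vscale y0 xw)) (cubic_polar xv yv),
   x0 * yz + y0 * xz + dot xv yw + dot xw yv).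

Definition vzero : vec := (0, 0, 0, 0, 0, 0).
Definition alg_zero : alg := (0, vzero, vzero, 0).
Definition alg_one : alg := (1, vzero, vzero, 0).

End CubicAlgebra.

Ltac alg_intro x :=
  move: x => [[[? [[[[[? ?] ?] ?] ?] ?]] [[[[[? ?] ?] ?] ?] ?]] ?].
Ltac alg_ring :=
  rewrite /alg_add /alg_mul /alg_opp /alg_zero /alg_one /vzero /vadd /vscale
    /cubic_polar /dot /vzero /=; repeat congr pair; ring.

Section AlgebraStructure.
Variable F : realFieldType.

Fact alg_addA : associative (@alg_add F).
Proof. by move=> x y z; alg_intro x; alg_intro y; alg_intro z; alg_ring. Qed.
Fact alg_addC : commutative (@alg_add F).
Proof. by move=> x y; alg_intro x; alg_intro y; alg_ring. Qed.
Fact alg_add0 : left_id (alg_zero F) (@alg_add F).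
Proof. by move=> x; alg_intro x; alg_ring. Qed.
Fact alg_addN : left_inverse (alg_zero F) (@alg_opp F) (@alg_add F).
Proof. by move=> x; alg_intro x; alg_ring. Qed.
HB.instance Definition _ :=
  GRing.isZmodule.Build (alg F) alg_addA alg_addC alg_add0 alg_addN.

(** The essential case is that of three elements of degree 1, where [dot (cubic_polar u v) w] is
    symmetric in all arguments, as the polarization of a cubic form. *)
Fact alg_mulA : associative (@alg_mul F).
Proof. by move=> x y z; alg_intro x; alg_intro y; alg_intro z; alg_ring. Qed.
Fact alg_mulC : commutative (@alg_mul F).
Proof. by move=> x y; alg_intro x; alg_intro y; alg_ring. Qed.
Fact alg_mul1 : left_id (alg_one F) (@alg_mul F).
Proof. by move=> x; alg_intro x; alg_ring. Qed.
Fact alg_mulDl : left_distributive (@alg_mul F) (@alg_add F).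
Proof. by move=> x y z; alg_intro x; alg_intro y; alg_intro z; alg_ring. Qed.
Fact alg_one_neq0 : alg_one F != alg_zero F.
Proof. by apply/eqP=> -[] /eqP; rewrite oner_eq0. Qed.
HB.instance Definition _ := GRing.Zmodule_isComNzRing.Build (alg F)
  alg_mulA alg_mulC alg_mul1 alg_mulDl alg_one_neq0.

End AlgebraStructure.

(** * The maximal ideal, Krull dimension 0 and the vanishing of its fourth power *)

Section LocalStructure.
Variable F : realFieldType.
Local Notation A := (alg F).

Definition aug (x : A) : F := x.1.1.1.
Definition deg1 (x : A) : vec F := x.1.1.2.
Definition deg3 (x : A) : F := x.2.
Definition scal (a : F) : A := (a, vzero F, vzero F, 0).

Lemma addE (x y : A) : x + y = alg_add x y. Proof. by []. Qed.
Lemma mulE (x y : A) : x * y = alg_mul x y. Proof. by []. Qed.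

Lemma augD x y : aug (x + y) = aug x + aug y.
Proof. by rewrite addE; alg_intro x; alg_intro y. Qed.
Lemma augM x y : aug (x * y) = aug x * aug y.
Proof. by rewrite mulE; alg_intro x; alg_intro y. Qed.
Lemma aug0 : aug 0 = 0. Proof. by []. Qed.
Lemma aug1 : aug 1 = 1. Proof. by []. Qed.
Lemma aug_scal a : aug (scal a) = a. Proof. by []. Qed.
Lemma augN x : aug (- x) = - aug x.
Proof. by apply: (addrI (aug x)); rewrite -augD !subrr. Qed.

Lemma scalD a b : scal (a + b) = scal a + scal b.
Proof. by rewrite addE /scal; alg_ring. Qed.
Lemma scalM a b : scal (a * b) = scal a * scal b.
Proof. by rewrite mulE /scal; alg_ring. Qed.
Lemma scal0 : scal 0 = 0. Proof. by []. Qed.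
Lemma scal1 : scal 1 = 1. Proof. by []. Qed.
Lemma scalN a : scal (- a) = - scal a.
Proof. by apply: (addrI (scal a)); rewrite -scalD !subrr. Qed.

Definition max_pred : A^o -> bool := fun x => aug x == 0.
Lemma max_predE (x : A) : (x \in max_pred) = (aug x == 0). Proof. by []. Qed.
Lemma max_pred_closed : submod_closed max_pred.
Proof.
split=> [|a x y]; rewrite !max_predE ?aug0 // => /eqP x0 /eqP y0.
by rewrite augD augM x0 y0 mulr0 addr0.
Qed.
HB.instance Definition _ :=
  GRing.isSubmodClosed.Build A A^o max_pred max_pred_closed.
Definition max_ideal : submodClosed A^o :=
  GRing.SubmodClosed.clone A _ max_pred _.

Lemma in_max_ideal (x : A) : (x \in max_ideal) = (aug x == 0). Proof. by []. Qed.

(** The grading stops in degree 3. *)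
Lemma mulr_aug0_nilp (x y z t : A) :
  aug x = 0 -> aug y = 0 -> aug z = 0 -> aug t = 0 -> x * y * z * t = 0.
Proof.
rewrite !mulE; alg_intro x; alg_intro y; alg_intro z; alg_intro t.
rewrite /aug /= => -> -> -> ->; have -> : (0 : A) = alg_zero F by [].
by alg_ring.
Qed.

Lemma aug_unit (x : A) : aug x != 0 -> exists y, y * x = 1.
Proof.
move=> x0; pose n := 1 - scal (aug x)^-1 * x.
have n0 : aug n = 0 by rewrite augD augN augM aug1 aug_scal mulVf // subrr.
(* The geometric series for the inverse of [1 - n], finite because [n] is nilpotent. *)
exists ((1 + n + n * n + n * n * n) * scal (aug x)^-1).
have -> : (1 + n + n * n + n * n * n) * scal (aug x)^-1 * x =
    (1 + n + n * n + n * n * n) * (1 - n) by rewrite /n; ring.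
have -> : (1 + n + n * n + n * n * n) * (1 - n) = 1 - n * n * n * n by ring.
by rewrite mulr_aug0_nilp // subr0.
Qed.

Lemma ideal_sub_max (I : submodClosed A^o) x : 1 \notin I -> x \in I -> aug x = 0.
Proof.
move=> I1 xI; apply/eqP; apply: contraNT I1 => /aug_unit[y <-].
exact: (rpredZ y xI).
Qed.

Lemma max_ideal_maximal : maximal_ideal max_ideal.
Proof.
split=> [|I _ I1 x xI]; first by rewrite in_max_ideal aug1 oner_eq0.
by rewrite in_max_ideal (ideal_sub_max I1 xI).
Qed.

Lemma alg_local : local_ring max_ideal.
Proof.
split=> [|m' [m'1 m'max]]; first exact: max_ideal_maximal.
have m'm : {subset m' <= max_ideal}.
  by move=> x xm; rewrite in_max_ideal (ideal_sub_max m'1 xm).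
move=> x; apply/idP/idP; first exact: m'm.
apply: m'max => //; by case: max_ideal_maximal.
Qed.

Lemma max_ideal_prime : prime_ideal max_ideal.
Proof.
have [m1 _] := max_ideal_maximal; split=> // u v uv.
by have : aug (u * v) == 0 := uv; rewrite augM mulf_eq0.
Qed.

(** Elements of [max_ideal] are nilpotent, so every prime contains them. *)
Lemma prime_ideal_max (I : submodClosed A^o) : prime_ideal I -> I =i max_ideal.
Proof.
move=> [I1 Iprime] x; apply/idP/idP => [xI|].
  by rewrite in_max_ideal (ideal_sub_max I1 xI).
rewrite in_max_ideal => /eqP x0.
have : (x * x * x * x : A) \in I by rewrite mulr_aug0_nilp //; exact: (rpred0 I).
by do 3![case/Iprime/orP => //].
Qed.

Lemma alg_krull_dim : krull_dim A = 0%N.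
Proof.
have chain0 n : prime_chain A n -> n = 0%N.
  case: n => // n [p [pprime pchain]]; case: (pchain 0%N isT) => _ [] x.
  by rewrite !prime_ideal_max //; apply: pprime.
rewrite /krull_dim; case: xgetP => [d _ [/chain0 //]|/(_ 0%N)[]].
split=> [|n /chain0 -> //]; exists (fun=> max_ideal).
by split=> // i _; apply: max_ideal_prime.
Qed.

Lemma ideal_prod_sub (X Y Z : set A) :
    Z 0 -> (forall x y, Z x -> Z y -> Z (x + y)) ->
    (forall x y, X x -> Y y -> Z (x * y)) -> ideal_prod X Y `<=` Z.
Proof.
move=> Z0 ZD XY _ [n [a [b [ab ->]]]].
by elim/big_ind: _ => // i _; case: (ab i) => ? ?; apply: XY.
Qed.

Lemma max_ideal_pow4 : ideal_pow [set` max_ideal] 4 = [set 0].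
Proof.
(* [C k] is the annihilator of the [k]-fold products of elements of [m]. *)
pose C k : set A := [set x | forall a : 'I_k -> A,
  (forall i, aug (a i) = 0) -> (\prod_i a i) * x = 0].
have CP k x : aug x = 0 -> forall y, C k.+1 y -> C k (x * y).
  move=> x0 y Cy a a0.
  have /Cy : forall i, aug (oapp a x (unlift ord0 i)) = 0.
    by move=> i; case: unliftP => [j|] _ /=.
  rewrite big_ord_recl unlift_none /=; under eq_bigr do rewrite liftK /=.
  by rewrite mulrCA mulrA.
have C0 k : C k 0 by move=> a _; rewrite mulr0.
have CD k x y : C k x -> C k y -> C k (x + y).
  by move=> Cx Cy a a0; rewrite mulrDr Cx // Cy // addr0.
(* For [k = 0] the set [C 4] is everything, by nilpotence; for [k = 4] the only product is the empty
   one, so [C 0] is zero. *)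
have powC k : (k <= 4)%N -> ideal_pow [set` max_ideal] k `<=` C (4 - k)%N.
  elim: k => [_ x _ a a0|k IH k4].
    rewrite !big_ord_recr big_ord0 /= mul1r.
    by rewrite (mulr_aug0_nilp (a0 _) (a0 _) (a0 _) (a0 _)) mul0r.
  apply: ideal_prod_sub => [|x y|x y xm ym]; [exact: C0 | exact: CD |].
  have {}ym : C (4 - k)%N y := IH (ltnW k4) _ ym.
  have x0 : aug x = 0 by apply/eqP; move: xm; rewrite /= in_max_ideal.
  by move: ym; rewrite -subnSK //; apply: CP.
apply/seteqP; split=> [x x4|_ ->].
  have Cx : C (4 - 4)%N x := powC 4 isT _ x4.
  by have := Cx (fun=> 0) (fun=> aug0); rewrite big_ord0 mul1r.
by exists 0%N, (fun=> 0), (fun=> 0); split=> [[]|]; rewrite ?big_ord0.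
Qed.

End LocalStructure.

(** * Dimension counts over the ground field; the algebra is Noetherian *)

Section Spans.
Variable F : realFieldType.
Local Notation A := (alg F).

(** The images under [l] of the generators span [F^d], since [A] acts there through [aug]. *)
Lemma generated_by_lower (X : lmodType A) d p (l : X -> 'rV[F]_d) :
    (forall x y, l (x + y) = l x + l y) ->
    (forall a x, l (a *: x) = aug a *: l x) ->
    (forall v, exists x, l x = v) ->
  generated_by p X -> (d <= p)%N.
Proof.
move=> lD lZ lsurj [g gP].
have l0 : l 0 = 0 by rewrite -(scale0r (0 : X)) lZ aug0 scale0r.
pose G := \matrix_(i < p) l (g i).
suff : row_full G by move=> /eqP <-; apply: rank_leq_row.
rewrite -sub1mx; apply/row_subP => i; have [x <-] := lsurj (row i 1%:M).
have [c ->] := gP x.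
have -> : l (\sum_i c i *: g i) = \sum_i aug (c i) *: row i G.
  rewrite (big_morph l lD l0); apply: eq_bigr => j _.
  by rewrite lZ rowK.
by apply: summx_sub => j _; apply: scalemx_sub; apply: row_sub.
Qed.

(** Spanning over the subfield [scal] rather than over [A]: such a bound passes to submodules with
    the same number of elements, unlike a bound on generators. *)
Definition spanned (I : finType) (X : lmodType A) :=
  exists e : I -> X, forall x : X, exists c : I -> F, x = \sum_i scal (c i) *: e i.

Lemma spanned_ord (I : finType) X : spanned I X -> spanned 'I_#|I| X.
Proof.
move=> [e eP]; exists (fun i => e (enum_val i)) => x; have [c ->] := eP x.
exists (fun i => c (enum_val i)).
by rewrite (reindex _ (onW_bij _ (@enum_val_bij I))).
Qed.

Lemma spanned_generated n X : spanned 'I_n X -> generated_by n X.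
Proof.
move=> [e eP]; exists e => x; have [c xc] := eP x.
by exists (fun i => scal (c i)).
Qed.

Lemma spanned_surj I (X Y : lmodType A) (f : {linear X -> Y}) :
  (forall y, exists x, f x = y) -> spanned I X -> spanned I Y.
Proof.
move=> fsurj [e eP]; exists (f \o e) => y; have [x <-] := fsurj y.
have [c ->] := eP x; exists c; rewrite linear_sum; apply: eq_bigr => i _.
by rewrite linearZ.
Qed.

Lemma spanned_quot I (X : lmodType A) (S : submodClosed X) :
  spanned I X -> spanned I (quotmod S).
Proof.
apply: (@spanned_surj I X (quotmod S) (@quotmod_pi _ X S)) => y.
by have [x ->] := quotmod_pi_surj y; exists x.
Qed.

(** Among the matrices with rows in [P], one of maximal rank works: adjoining a further vector of
    [P] cannot raise the rank. *)
Lemma subspace_row_space n (P : 'rV[F]_n -> Prop) :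
    P 0 -> (forall a u v, P u -> P v -> P (a *: u + v)) ->
  exists B : 'M[F]_n, (forall i, P (row i B)) /\ forall v, P v -> (v <= B)%MS.
Proof.
move=> P0 Plin.
pose q r := `[< exists B : 'M[F]_n, (forall i, P (row i B)) /\ \rank B = r >].
have q0 : exists r, q r.
  exists 0%N; apply/asboolP; exists 0; split; last exact: mxrank0.
  by move=> i; rewrite row0.
have qn r : q r -> (r <= n)%N by move=> /asboolP[B [_ <-]]; apply: rank_leq_row.
case: (ex_maxnP q0 qn) => r /asboolP[B [BP rB]] rmax; exists B; split=> // v Pv.
have PB m (D : 'M[F]_(1, m)) (C : 'M[F]_(m, n)) :
    (forall i, P (row i C)) -> P (D *m C).
  move=> PC; rewrite mulmx_sum_row; elim/big_ind: _ => // [x y Px Py|i _].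
    by rewrite -[x]scale1r; apply: Plin.
  by rewrite -[_ *: _]addr0; apply: Plin.
have sP i : P (row i (B + v)%MS).
  have /sub_addsmxP[[D1 D2] ->] := row_sub i (B + v)%MS.
  rewrite -[_ *m B]scale1r; apply: Plin; apply: PB => // j.
  by rewrite (ord1 j) row_id.
have /rmax : q (\rank (B + v)%MS) by apply/asboolP; exists (B + v)%MS.
rewrite -rB => le_r.
have := mxrank_leqif_sup (addsmxSl B v).
move=> [le_r' /esym]; rewrite eqn_leq le_r' le_r => Bv.
exact: submx_trans (addsmxSr B v) Bv.
Qed.

Lemma spanned_submod n (X : lmodType A) (S : submodClosed X) :
  spanned 'I_n X -> spanned 'I_n (submod S).
Proof.
move=> [e eP]; pose comb (c : 'rV[F]_n) := \sum_j scal (c 0 j) *: e j.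
have combP a u v : comb (a *: u + v) = scal a *: comb u + comb v.
  rewrite /comb scaler_sumr -big_split; apply: eq_bigr => j _ /=.
  by rewrite !mxE scalD scalM scalerDl scalerA.
have comb0 : comb 0 = 0.
  by rewrite /comb big1 // => j _; rewrite mxE scal0 scale0r.
have [|a u v uS vS|B [BS Bmax]] :=
    @subspace_row_space n (fun c => comb c \in S).
- by rewrite comb0 rpred0.
- by rewrite combP rpredD // rpredZ.
exists (fun i => Submod (BS i)) => -[x xS].
have [c xc] := eP x.
have xrow : x = comb (\row_j c j).
  by rewrite xc; apply: eq_bigr => j _; rewrite mxE.
have /Bmax/submxP[D cD] : comb (\row_j c j) \in S by rewrite -xrow.
exists (D 0); apply: val_inj; rewrite (linear_sum val).
have -> : val (Submod xS) = comb (D *m B) by rewrite -cD.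
rewrite mulmx_sum_row (big_morph comb (id1 := 0) (op1 := +%R)) //.
  apply: eq_bigr => i _; rewrite (linearZ_LR val) /=.
  by rewrite -[_ *: row i B]addr0 combP comb0 addr0.
by move=> u v; rewrite -{1}[u]scale1r combP scal1 scale1r.
Qed.

(** Ordered by degree: positions 1 to 6 and 7 to 12 hold dual bases of [V] and [V*], position 13 the
    socle. *)
Definition alg_basis : seq A :=
  [:: (1, vzero F, vzero F, 0);
   (0, (1, 0, 0, 0, 0, 0), vzero F, 0); (0, (0, 1, 0, 0, 0, 0), vzero F, 0);
   (0, (0, 0, 1, 0, 0, 0), vzero F, 0); (0, (0, 0, 0, 1, 0, 0), vzero F, 0);
   (0, (0, 0, 0, 0, 1, 0), vzero F, 0); (0, (0, 0, 0, 0, 0, 1), vzero F, 0);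
   (0, vzero F, (1, 0, 0, 0, 0, 0), 0); (0, vzero F, (0, 1, 0, 0, 0, 0), 0);
   (0, vzero F, (0, 0, 1, 0, 0, 0), 0); (0, vzero F, (0, 0, 0, 1, 0, 0), 0);
   (0, vzero F, (0, 0, 0, 0, 1, 0), 0); (0, vzero F, (0, 0, 0, 0, 0, 1), 0);
   (0, vzero F, vzero F, 1)].

Lemma spanned_alg : spanned 'I_14 A^o.
Proof.
exists (fun i : 'I_14 => nth (0 : A) alg_basis i : A^o) => -[[[a [[[[[b1 b2] b3] b4] b5] b6]]
  [[[[[c1 c2] c3] c4] c5] c6]] d].
exists (fun i : 'I_14 => nth 0 [:: a; b1; b2; b3; b4; b5; b6; c1; c2; c3; c4; c5; c6; d] i).
rewrite !big_ord_recl big_ord0 addr0 /=.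
rewrite /GRing.scale /= !mulE !addE /scal.
rewrite /alg_add /alg_mul /alg_zero /vzero /vadd /vscale /cubic_polar /dot.
by repeat congr pair; ring.
Qed.

Lemma generated_spanned n X : generated_by n X -> spanned ('I_n * 'I_14)%type X.
Proof.
move=> [g gP]; have [b bP] := spanned_alg.
exists (fun ij => (b ij.2 : A) *: g ij.1) => x; have [c ->] := gP x.
have /choice[d dP] i : exists d : 'I_14 -> F, c i = \sum_j scal (d j) *: b j.
  exact: bP.
exists (fun ij => d ij.1 ij.2).
rewrite -(pair_bigA_idem (addr0 0) (fun i j => scal (d i j) *: ((b j : A) *: g i))) /=.
apply: eq_bigr => i _; rewrite dP scaler_suml; apply: eq_bigr => j _.
by rewrite scalerA.
Qed.

Lemma alg_noetherian : noetherian A.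
Proof.
move=> I; exists 14%N; apply: spanned_generated; apply: spanned_submod.
exact: spanned_alg.
Qed.

End Spans.

(** * Codimension 6 and self-injectivity *)

Section Gorenstein.
Variable F : realFieldType.
Local Notation A := (alg F).

Definition var (i : 'I_6) : A := nth 0 (alg_basis F) i.+1.

Lemma aug_var i : aug (var i) = 0.
Proof. by case: i => -[|[|[|[|[|[|]]]]]]. Qed.

Definition vrow (v : vec F) : 'rV[F]_6 :=
  let: (v1, v2, v3, v4, v5, v6) := v in
  \row_(i < 6) nth 0 [:: v1; v2; v3; v4; v5; v6] i.

Lemma vrow_lin a u v : vrow (vadd (vscale a u) v) = a *: vrow u + vrow v.
Proof.
move: u v => [[[[[? ?] ?] ?] ?] ?] [[[[[? ?] ?] ?] ?] ?].
by apply/rowP => -[[|[|[|[|[|[|]]]]]] ?] //; rewrite /= !mxE.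
Qed.

Lemma deg1D (x y : A) : deg1 (x + y) = vadd (deg1 x) (deg1 y).
Proof. by rewrite addE; alg_intro x; alg_intro y. Qed.

Lemma deg1M (x y : A) :
  deg1 (x * y) = vadd (vscale (aug x) (deg1 y)) (vscale (aug y) (deg1 x)).
Proof. by rewrite mulE; alg_intro x; alg_intro y. Qed.

Lemma vscale1 (v : vec F) : vscale 1 v = v.
Proof. by move: v => [[[[[? ?] ?] ?] ?] ?]; rewrite /vscale !mul1r. Qed.

Lemma vrow_surj (r : 'rV[F]_6) : exists v, vrow v = r.
Proof.
pose c k : F := r 0 (inord k).
exists (c 0%N, c 1%N, c 2%N, c 3%N, c 4%N, c 5%N); apply/rowP => i.
by rewrite mxE -[in RHS](inord_val i); case: i => -[|[|[|[|[|[|]]]]]].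
Qed.

Lemma max_ideal_generated : generated_by 6 (submod (max_ideal F)).
Proof.
have varm i : (var i : A^o) \in max_ideal F by rewrite in_max_ideal aug_var.
exists (fun i => Submod (varm i)) => -[[[[x0 [[[[[v1 v2] v3] v4] v5] v6]]
  [[[[[w1 w2] w3] w4] w5] w6]] z] xm].
have x00 : x0 = 0 by apply/eqP; move: xm; rewrite in_max_ideal.
pose vz := vzero F.
(* The degree 2 part is reached by the products x2 x6, x1 x6, x1 x3 and x1 x2, except for its third
   and fourth coordinates: these come from x1 x5 = (0,0,1,1,0,0) and x2 x5 = (0,0,-2,-1,0,0). The
   socle is x1 times its dual element. *)
pose c : seq A := [:: (v1, vz, (z, 0, 0, 0, 0, 0), 0); (v2, (w6, 0, 0, 0, 0, 0), vz, 0);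
  (v3, (w5, 0, 0, 0, 0, 0), vz, 0); (v4, vz, vz, 0);
  (v5, (2 * w4 - w3, w4 - w3, 0, 0, 0, 0), vz, 0); (v6, (w2, w1, 0, 0, 0, 0), vz, 0)].
exists (fun i : 'I_6 => nth 0 c i); apply: val_inj.
rewrite (linear_sum val) !big_ord_recl big_ord0 addr0 /= x00 /c /vz.
rewrite /GRing.scale /= !mulE !addE.
by alg_ring.
Qed.

Lemma alg_codim : codim (max_ideal F) = 6%:Z.
Proof.
rewrite /codim alg_krull_dim subr0; congr Posz.
have [gen6 min6] := num_gensP max_ideal_generated.
apply/eqP; rewrite eqn_leq (min6 _ max_ideal_generated) /=.
have m0 (x : submod (max_ideal F)) : aug (val x) = 0.
  by apply/eqP; have := valP x; rewrite in_max_ideal.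
apply: (generated_by_lower (l := fun x : submod (max_ideal F) => vrow (deg1 (val x))))
  gen6 => [x y|a x|r].
- rewrite (linearD val) deg1D -[deg1 (val x)]vscale1 vrow_lin scale1r.
  by rewrite vscale1.
- rewrite (linearZ_LR val) deg1M m0.
  rewrite vrow_lin (_ : vrow (vscale 0 (deg1 a)) = 0) ?addr0 //.
  move: (deg1 a) => [[[[[? ?] ?] ?] ?] ?].
  by apply/rowP => -[[|[|[|[|[|[|]]]]]] ?] //; rewrite /= !mxE /= mul0r.
- have [v <-] := vrow_surj r.
  have vm : ((0, v, vzero F, 0) : A^o) \in max_ideal F by rewrite in_max_ideal.
  by exists (Submod vm).
Qed.

(* The inverse of the isomorphism from [A] to its [F]-dual given by the socle
   coordinate: the basis of degree [i] is dual to that of degree [3 - i]. *)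
Definition of_functional (G : A -> F) : A :=
  let e k := G (nth 0 (alg_basis F) k) in
  (e 13%N, (e 7%N, e 8%N, e 9%N, e 10%N, e 11%N, e 12%N),
   (e 1%N, e 2%N, e 3%N, e 4%N, e 5%N, e 6%N), e 0%N).

Lemma of_functionalP (G : A -> F) :
  (forall a x y, G (scal a * x + y) = a * G x + G y) ->
  forall y, deg3 (y * of_functional G) = G y.
Proof.
move=> Glin [[[a [[[[[b1 b2] b3] b4] b5] b6]] [[[[[c1 c2] c3] c4] c5] c6]] d].
have G0 : G 0 = 0 by have := Glin (-1) 0 0; rewrite mulr0 addr0; lra.
pose cs := [:: a; b1; b2; b3; b4; b5; b6; c1; c2; c3; c4; c5; c6; d].
pose y : A := (a, (b1, b2, b3, b4, b5, b6), (c1, c2, c3, c4, c5, c6), d).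
have yE : y = \sum_(k < 14) scal (nth 0 cs k) * nth 0 (alg_basis F) k.
  rewrite !big_ord_recl big_ord0 addr0 /= !mulE !addE /scal.
  by alg_ring.
have -> : G y = \sum_(k < 14) nth 0 cs k * G (nth 0 (alg_basis F) k).
  by rewrite yE !big_ord_recl !big_ord0 !Glin G0.
rewrite !big_ord_recl big_ord0 mulE /of_functional /deg3.
by rewrite /alg_mul /vzero /vadd /vscale /cubic_polar /dot /=; ring.
Qed.

(** The socle pairing is nondegenerate: pairing with the dual basis reads off every coordinate. *)
Lemma deg3_inj (x y : A) : (forall z, deg3 (z * x) = deg3 (z * y)) -> x = y.
Proof.
move=> xy; have key (u : A) : u = of_functional (fun z => deg3 (z * u)).
  rewrite /of_functional /= !mulE; alg_intro u.
  by rewrite /deg3 /=; alg_ring.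
by rewrite [x]key [y]key; congr of_functional; apply/funext.
Qed.

(** [B] may have infinite dimension over [F], hence the use of Zorn's lemma. *)
Lemma subspace_complement (B : lmodType A) (Q : set B) :
    Q 0 -> (forall a u v, Q u -> Q v -> Q (scal a *: u + v)) ->
  exists C : set B, [/\ forall a u v, C u -> C v -> C (scal a *: u + v),
    forall u, C u -> Q u -> u = 0 & forall x, exists q c, [/\ Q q, C c & x = q + c]].
Proof.
move=> Q0 Qlin.
pose P (C : set B) := (forall a u v, C u -> C v -> C (scal a *: u + v)) /\
  forall u, C u -> Q u -> u = 0.
have [|C [[Clin CQ] Cmax]] := @Zorn_bigcup B P.
  move=> S SP Stot; split=> [a u v [X SX Xu] [Y SY Yv]|u [X SX Xu]].
    have [XY|YX] := Stot _ _ SX SY.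
      by exists Y => //; apply: (SP _ SY).1 => //; apply: XY.
    by exists X => //; apply: (SP _ SX).1 => //; apply: YX.
  exact: (SP _ SX).2.
(* [P] does not demand [C 0], because the empty chain has empty union; maximality supplies it. *)
have C0 : C 0.
  apply: contrapT => nC0.
  have Cempty x : ~ C x.
    move=> Cx; apply: nC0; have := Clin (-1) x x Cx Cx.
    by rewrite scalN scal1 scaleN1r addNr.
  apply: (Cmax [set 0]); first by split=> [x /Cempty|/(_ 0 erefl)].
  by split=> [a u v -> ->|u ->//]; rewrite scaler0 addr0.
exists C; split=> // x; apply: contrapT => nx.
pose C' : set B := [set y | exists a c, C c /\ y = scal a *: x + c].
have CC' : C `<=` C' by move=> y Cy; exists 0, y; rewrite scal0 scale0r add0r.
apply: (Cmax C'); last split=> [a _ _ [b [c [Cc ->]]] [b' [c' [Cc' ->]]]|_ [a [c [Cc ->]]] Qu].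
- split=> // C'C; apply: nx; exists 0, x; split=> //; rewrite ?add0r //.
  by apply: C'C; exists 1, 0; rewrite scal1 scale1r addr0.
- exists (a * b + b'), (scal a *: c + c'); split; first exact: Clin.
  by rewrite scalerDr scalerA -scalM scalD scalerDl addrACA.
- have [a0|a0] := eqVneq a 0.
    by rewrite a0 scal0 scale0r add0r in Qu *; apply: CQ.
  case: nx; exists (scal a^-1 *: (scal a *: x + c)), (- (scal a^-1 *: c)); split.
  + by rewrite -[_ *: _]addr0; apply: Qlin.
  + by have := Clin (- a^-1) c 0 Cc C0; rewrite addr0 scalN scaleNr.
  + by rewrite scalerDr scalerA -scalM mulVf // scal1 scale1r addrK.
Qed.

(** The socle pairing identifies [A] with its [F]-dual, so an [A]-linear map into [A] amounts to an
    [F]-linear functional, and functionals extend along injections. *)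
Lemma alg_self_injective : injective_module A^o.
Proof.
move=> X Y f g finj.
pose Q : set Y := [set y | exists x, f x = y].
have [||C [Clin CQ QC]] := @subspace_complement Y Q.
- by exists 0; rewrite linear0.
- by move=> a _ _ [x <-] [x' <-]; exists (scal a *: x + x'); rewrite linearP.
(* [s] is the [F]-linear retraction of [f] that vanishes on the complement [C]. *)
have /choice[s sP] y : exists x, C (y - f x).
  by have [_ [c [[x <-] Cc ->]]] := QC y; exists x; rewrite addrAC subrr add0r.
have Csub u v : C u -> C v -> C (u - v).
  by move=> Cu Cv; have := Clin (-1) v u Cv Cu; rewrite scalN scal1 scaleN1r addrC.
have slin a u v : s (scal a *: u + v) = scal a *: s u + s v.
  apply: finj; apply/eqP; rewrite -subr_eq0; apply/eqP/CQ; last first.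
    by exists (s (scal a *: u + v) - (scal a *: s u + s v)); rewrite linearB.
  have := Csub _ _ (Clin a _ _ (sP u) (sP v)) (sP (scal a *: u + v)).
  congr C; rewrite scalerBr (linearP f) addrACA -opprD opprB.
  by rewrite [LHS]addrC addrA subrK.
have sf x : s (f x) = x.
  apply: finj; apply/eqP; rewrite -subr_eq0 -opprB oppr_eq0; apply/eqP/CQ.
    exact: sP.
  by exists (x - s (f x)); rewrite linearB.
pose G (y : Y) : F := deg3 (g (s y) : A).
have deg3_lin a (u v : A) : deg3 (scal a * u + v) = a * deg3 u + deg3 v.
  rewrite mulE addE; alg_intro u; alg_intro v; rewrite /deg3 /=.
  by rewrite /dot /vzero; ring.
have Glin a u v : G (scal a *: u + v) = a * G u + G v.
  by rewrite /G slin linearP -deg3_lin.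
pose h (y : Y) : A^o := of_functional (fun z => G (z *: y)).
have hP z y : deg3 (z * h y) = G (z *: y).
  rewrite /h (of_functionalP (G := fun z => G (z *: y))) // => a u v.
  by rewrite -Glin scalerDl scalerA.
have hlin : linear h.
  move=> a u v; apply: deg3_inj => z; rewrite hP.
  have -> : z * (a *: h u + h v) = scal 1 * (z * a * h u) + z * h v.
    by rewrite scal1 mul1r mulrDr mulrA.
  rewrite deg3_lin !hP mul1r.
  have := Glin 1 ((z * a) *: u) (z *: v); rewrite scal1 scale1r mul1r => <-.
  by rewrite scalerDr scalerA.
pose H : {linear Y -> A^o} := HB.pack h (GRing.isLinear.Build A Y A^o *:%R h hlin).
exists H => x; apply: deg3_inj => z; rewrite hP -linearZ /G sf.
by rewrite linearZ.
Qed.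

Lemma alg_gorenstein : gorenstein_local (max_ideal F).
Proof.
split; [exact: alg_noetherian | exact: alg_local |].
by exists 0%N; apply: alg_self_injective.
Qed.

End Gorenstein.

(** * Upper and lower bounds on Ext *)

Section FiniteResolution.
Variable F : realFieldType.
Local Notation A := (alg F).

Definition free n : lmodType A := {ffun 'I_n -> A^o}.

Definition free_comb (M : lmodType A) n (g : 'I_n -> M) (x : free n) : M :=
  \sum_i (x i : A) *: g i.

Lemma free_comb_linear (M : lmodType A) n (g : 'I_n -> M) : linear (free_comb g).
Proof.
move=> a x y; rewrite /free_comb scaler_sumr -big_split; apply: eq_bigr => i _ /=.
by rewrite !ffunE scalerDl scalerA.
Qed.
HB.instance Definition _ (M : lmodType A) n (g : 'I_n -> M) :=
  GRing.isLinear.Build A (free n) M *:%R (free_comb g) (free_comb_linear g).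

Definition free_gen n (i : 'I_n) : free n := [ffun j => (i == j)%:R : A^o].

Lemma free_genE n (x : free n) : x = free_comb (@free_gen n) x.
Proof.
apply/ffunP => j; rewrite /free_comb sum_ffunE (bigD1 j) //= big1 ?addr0.
  by rewrite !ffunE eqxx /GRing.scale /= mulr1.
by move=> i ij; rewrite !ffunE (negbTE ij) /GRing.scale /= mulr0.
Qed.

Lemma free_linearE (M : lmodType A) n (f : {linear free n -> M}) x :
  f x = free_comb (f \o @free_gen n) x.
Proof.
by rewrite [in LHS](free_genE x) linear_sum; apply: eq_bigr => i _; rewrite linearZ.
Qed.

Lemma free_projective n : projective_module (free n).
Proof.
move=> X Y g h gsurj; have /choice[s sP] i := gsurj (h (free_gen i)).
exists (free_comb s) => x; rewrite [in RHS]free_linearE /free_comb linear_sum.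
by apply: eq_bigr => i _; rewrite linearZ /= sP.
Qed.

Lemma spanned_hom n (I : finType) (N : lmodType A) :
  spanned I N -> spanned ('I_n * I)%type (Defs.hom (free n) N).
Proof.
move=> [e eP].
exists (fun ij => free_comb (fun k => (ij.1 == k)%:R *: e ij.2) :
  Defs.hom (free n) N) => f.
have /choice[c cP] i := eP (f (free_gen i)).
exists (fun ij => c ij.1 ij.2); apply: hom_ext => x.
rewrite free_linearE {1}/free_comb.
have -> (J : finType) (G : J -> Defs.hom (free n) N) :
    (\sum_j G j : Defs.hom (free n) N) x = \sum_j G j x.
  by elim/big_rec2: _ => [|j u v _ <-].
rewrite -(pair_bigA_idem (addr0 0) (fun i j => (scal (c i j) *:
  (free_comb (fun k => (i == k)%:R *: e j) : Defs.hom (free n) N) :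
    Defs.hom (free n) N) x)) /=.
apply: eq_bigr => i _; rewrite cP scaler_sumr; apply: eq_bigr => j _ /=.
rewrite /free_comb (bigD1 i) //= big1 ?addr0 ?eqxx ?scale1r.
  by rewrite !scalerA mulrC.
by move=> k ki; rewrite eq_sym (negbTE ki) scale0r scaler0.
Qed.

Lemma ext_generated_spanned (M N : lmodType A) (P : proj_resolution M) i (I : finType) :
  spanned I (Defs.hom (res_mod P i) N) -> generated_by #|I| (ext_of N P i).
Proof.
by move=> /spanned_ord sp; apply/spanned_generated/spanned_quot/spanned_submod.
Qed.

(** The generators are part of the data, so that taking syzygies can be iterated with control of
    their number. *)
Record fg_module := FgModule {
  fg_mod :> lmodType A;
  fg_num : nat;
  fg_gen : 'I_fg_num -> fg_mod;
  fg_genP : Defs.surjective (free_comb fg_gen)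
}.

Definition fg_ker (X : fg_module) : submodClosed (free (fg_num X)) :=
  GRing.SubmodClosed.clone A _ (Defs.kernel (free_comb (@fg_gen X))) _.

Lemma in_fg_ker (X : fg_module) x :
  (x \in fg_ker X) = (free_comb (@fg_gen X) x == 0).
Proof. by []. Qed.

Lemma spanned_free n : spanned ('I_n * 'I_14)%type (free n).
Proof.
apply: generated_spanned; exists (@free_gen n) => x; exists x.
exact: free_genE.
Qed.

(** [free n] has dimension [14 n] over [F], so as many elements span the kernel. The bound is crude,
    but iterating it gives an exponential one. *)
Lemma fg_ker_generated (X : fg_module) :
  exists g : 'I_(#|{: 'I_(fg_num X) * 'I_14}|) -> submod (fg_ker X),
    Defs.surjective (free_comb g).
Proof.
have := spanned_submod (fg_ker X) (spanned_ord (@spanned_free (fg_num X))).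
move=> /spanned_generated[g gP]; exists g => x; have [c ->] := gP x.
exists [ffun i => c i]; rewrite /free_comb; apply: eq_bigr => i _.
by rewrite ffunE.
Qed.

Definition fg_syz (X : fg_module) : fg_module :=
  FgModule (svalP (cid (fg_ker_generated X))).

Lemma fg_num_syz X : fg_num (fg_syz X) = (fg_num X * 14)%N.
Proof. by rewrite /= card_prod !card_ord. Qed.

Definition fg_iter X i := iter i fg_syz X.

Lemma fg_num_iter X i : fg_num (fg_iter X i) = (fg_num X * 14 ^ i)%N.
Proof.
elim: i => [|i IH]; first by rewrite muln1.
by rewrite [fg_iter X i.+1]/= fg_num_syz IH expnSr mulnA.
Qed.

Definition fg_cover (X : fg_module) : {linear free (fg_num X) -> X} :=
  free_comb (@fg_gen X).

Definition fg_diff (X : fg_module) i :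
    {linear free (fg_num (fg_iter X i.+1)) -> free (fg_num (fg_iter X i))} :=
  (val : submod (fg_ker (fg_iter X i)) -> free (fg_num (fg_iter X i)))
    \o fg_cover (fg_iter X i.+1).

Lemma fg_exact0 (X : fg_module) i : exact_at (fg_diff X i) (fg_cover (fg_iter X i)).
Proof.
move=> y; split=> [y0|[x <-]]; last first.
  by apply/eqP; rewrite -in_fg_ker; exact: (valP (fg_cover (fg_iter X i.+1) x)).
have yK : y \in fg_ker (fg_iter X i) by rewrite in_fg_ker; apply/eqP.
have [x xy] := @fg_genP (fg_iter X i.+1) (Submod yK : submod (fg_ker (fg_iter X i))).
by exists x; rewrite /fg_diff /= /fg_cover xy.
Qed.

Lemma fg_exactS (X : fg_module) i : exact_at (fg_diff X i.+1) (fg_diff X i).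
Proof.
move=> y; rewrite -fg_exact0 /fg_diff /=; split=> [y0|->]; last exact: (linear0 val).
apply: val_inj; rewrite -[RHS]/(val (0 : submod _)) (linear0 val). exact: y0.
Qed.

Definition fg_resolution (X : fg_module) : proj_resolution X := ProjResolution
  (fun i => @free_projective (fg_num (fg_iter X i))) (@fg_genP X)
  (@fg_exact0 X 0) (@fg_exactS X).

Lemma ext_generated_upper (M N : lmodType A) : fin_gen M -> fin_gen N ->
  exists C, forall i, generated_by (C * 14 ^ i) (ext i M N).
Proof.
move=> [m [g gP]] [n /generated_spanned spN].
have gsurj : Defs.surjective (free_comb g).
  move=> x; have [c ->] := gP x; exists [ffun i => c i].
  by apply: eq_bigr => i _; rewrite ffunE.
pose X := FgModule gsurj; exists (m * (n * 14))%N => i.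
have := ext_generated_spanned (P := fg_resolution X) (i := i)
  (spanned_hom (fg_num (fg_iter X i)) spN).
rewrite !card_prod !card_ord fg_num_iter /= mulnAC.
exact: ext_generated_resolution.
Qed.

End FiniteResolution.

(** * Exponential lower bound from the square-zero subring *)

Section LowerBound.
Variable F : realFieldType.
Local Notation A := (alg F).

(* The residue field, on the carrier [F] itself. *)
Definition resf : Type := F.
HB.instance Definition _ := GRing.Zmodule.on resf.
Definition resf_scale (a : A) (x : resf) : resf := aug a * x.
Fact resf_scaleA a b x : resf_scale a (resf_scale b x) = resf_scale (a * b) x.
Proof. by rewrite /resf_scale augM mulrA. Qed.
Fact resf_scale1 : left_id 1 resf_scale.
Proof. by move=> x; rewrite /resf_scale aug1 mul1r. Qed.
Fact resf_scaleDr : right_distributive resf_scale +%R.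
Proof. by move=> a x y; rewrite /resf_scale mulrDr. Qed.
Fact resf_scaleDl x : {morph resf_scale^~ x : a b / a + b}.
Proof. by move=> a b; rewrite /resf_scale augD mulrDl. Qed.
HB.instance Definition _ := GRing.Zmodule_isLmodule.Build A resf
  resf_scaleA resf_scale1 resf_scaleDr resf_scaleDl.

Lemma resf_scaleE (a : A) (x : resf) : a *: x = (aug a * x : F).
Proof. by []. Qed.

(* The quotient [F[t]/(t^2)] of [A] in which the [i]-th variable acts as [c_i t]. *)
Definition dualnum (c : vec F) : Type := (F * F)%type.
HB.instance Definition _ c := GRing.Zmodule.on (dualnum c).

Section DualNumbers.
Variable c : vec F.
Local Notation D := (dualnum c).

Definition slope (a : A) : F := dot c (deg1 a).

Lemma slopeD a b : slope (a + b) = slope a + slope b.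
Proof.
rewrite /slope addE; alg_intro a; alg_intro b.
by case: c => -[[[[? ?] ?] ?] ?] ?; rewrite /deg1 /=; ring.
Qed.

Lemma slopeM a b : slope (a * b) = aug a * slope b + aug b * slope a.
Proof.
rewrite /slope mulE; alg_intro a; alg_intro b.
by case: c => -[[[[? ?] ?] ?] ?] ?; rewrite /deg1 /aug /=; ring.
Qed.

Lemma slope1 : slope 1 = 0.
Proof. by rewrite /slope; case: c => -[[[[? ?] ?] ?] ?] ?; rewrite /=; ring. Qed.

Definition dualnum_scale (a : A) (x : D) : D :=
  (aug a * x.1, aug a * x.2 + slope a * x.1).
Fact dualnum_scaleA a b x :
  dualnum_scale a (dualnum_scale b x) = dualnum_scale (a * b) x.
Proof. by rewrite /dualnum_scale /= augM slopeM; congr pair; ring. Qed.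
Fact dualnum_scale1 : left_id 1 dualnum_scale.
Proof.
by move=> [x y]; rewrite /dualnum_scale aug1 slope1 /=; congr pair; ring.
Qed.
Fact dualnum_scaleDr : right_distributive dualnum_scale +%R.
Proof. by move=> a [x y] [x' y']; congr pair; rewrite /=; ring. Qed.
Fact dualnum_scaleDl x : {morph dualnum_scale^~ x : a b / a + b}.
Proof.
move=> a b; rewrite /dualnum_scale augD slopeD.
by case: x => x y; congr pair; rewrite /=; ring.
Qed.
HB.instance Definition _ := GRing.Zmodule_isLmodule.Build A D
  dualnum_scaleA dualnum_scale1 dualnum_scaleDr dualnum_scaleDl.

Lemma dualnum_scaleE (a : A) (x : D) :
  a *: x = (aug a * x.1, aug a * x.2 + slope a * x.1) :> F * F.
Proof. by []. Qed.

Definition dualnum_fst (x : D) : resf := x.1.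
Fact dualnum_fst_linear : linear dualnum_fst.
Proof. by []. Qed.
HB.instance Definition _ :=
  GRing.isLinear.Build A D resf *:%R dualnum_fst dualnum_fst_linear.

Lemma dualnum_fst_surj : Defs.surjective dualnum_fst.
Proof. by move=> x; exists (x, 0). Qed.

End DualNumbers.

(** The indices of [var] start at 0, so [true] stands for x5 and [false] for x6. *)
Definition uvar (b : bool) : A := if b then var F (inord 4) else var F (inord 5).
Definition ucoord (b : bool) : vec F :=
  if b then (0, 0, 0, 0, 1, 0) else (0, 0, 0, 0, 0, 1).

Lemma uvarE b : uvar b = (0, ucoord b, vzero F, 0).
Proof. by case: b; rewrite /uvar /var inordK. Qed.

Lemma aug_uvar b : aug (uvar b) = 0. Proof. by rewrite uvarE. Qed.

(** No monomial of the cubic form is divisible by X5^2, X5 X6 or X6^2. *)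
Lemma uvarM b b' : uvar b * uvar b' = 0.
Proof.
rewrite !uvarE mulE; have -> : (0 : A) = alg_zero F by [].
by case: b; case: b'; rewrite /alg_mul /alg_zero /vzero /vadd /vscale
  /cubic_polar /dot /=; repeat congr pair; ring.
Qed.

Lemma slope_uvar b b' : slope (ucoord b) (uvar b') = (b == b')%:R.
Proof.
by rewrite uvarE /slope /deg1; case: b; case: b'; rewrite /dot /=; ring.
Qed.

(* Over the square-zero subring generated by [uvar], the [sigma t] span a direct
   summand of [X], a sum of copies of the residue field, on which the [A]-linear
   maps [eps t] restrict to the dual basis. *)
Definition split_family (T : finType) (X : lmodType A) :=
  exists (eps : T -> {linear X -> resf}) (sigma : T -> X),
    (forall t t', eps t (sigma t') = (t == t')%:R) /\
    (forall t b, uvar b *: sigma t = 0).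

(** Lift [sigma t] to [f t] in the cover. The elements [uvar b *: f t] lie in the syzygy, as
    [uvar b] kills [sigma t], and are killed in turn since the subring has square zero. For the dual
    maps, lift [eps t] from the residue field to the dual numbers on which [uvar b] acts as the
    nilpotent element: on the syzygy the first coordinate of the lift vanishes, so the second one is
    [A]-linear. *)
Lemma split_syzygy1 (T : finType) (X : lmodType A) : split_family T X ->
  exists (eps : T * bool -> {linear syzygy1 X -> resf})
         (sigma : T * bool -> syzygy1 X) (f : T -> free_cover X),
    [/\ forall t t', eps t (sigma t') = (t == t')%:R,
        forall t b, uvar b *: sigma t = 0
      & forall t, val (sigma t) = uvar t.2 *: f t.1].
Proof.
move=> [eps [sigma [es us]]].
have /choice[f fP] t := @eval_cover_surj A X (sigma t).
have uker tb : uvar tb.2 *: f tb.1 \in Defs.kernel (eval_cover X).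
  by apply/eqP; rewrite linearZ /= fP us.
pose sigma' tb : syzygy1 X := Submod (uker tb).
have lex (tb : T * bool) :
    exists l : {linear free_cover X -> dualnum (ucoord tb.2)},
    forall x, dualnum_fst (l x) = eps tb.1 (eval_cover X x).
  pose h : {linear free_cover X -> resf} := eps tb.1 \o eval_cover X.
  have [l lP] := @free_cover_projective A X _ _ (@dualnum_fst _) h
    (@dualnum_fst_surj (ucoord tb.2)).
  by exists l.
pose l tb := sval (cid (lex tb)).
have lP tb x : dualnum_fst (l tb x) = eps tb.1 (eval_cover X x).
  exact: (svalP (cid (lex tb))).
have l1 tb (x : syzygy1 X) : (l tb (val x)).1 = 0.
  have := lP tb (val x); have /eqP -> : eval_cover X (val x) == 0 := valP x.
  by rewrite linear0.
pose e tb (x : syzygy1 X) : resf := (l tb (val x)).2.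
have elin tb : linear (e tb).
  move=> a x y; rewrite /e (linearP val) linearP.
  by rewrite dualnum_scaleE /= l1 mulr0 addr0.
pose eps' tb : {linear syzygy1 X -> resf} :=
  HB.pack (e tb) (GRing.isLinear.Build A (syzygy1 X) resf *:%R (e tb) (elin tb)).
exists eps', sigma', f; split=> // [[t b] [t' b']|t b].
  transitivity (l (t, b) (uvar b' *: f t')).2; first by [].
  rewrite linearZ_LR dualnum_scaleE [LHS]/= aug_uvar mul0r add0r slope_uvar.
  rewrite -[(l _ _).1]/(dualnum_fst _) (lP (t, b)) fP es xpair_eqE.
  by case: eqP; case: eqP; rewrite ?mulr1 ?mulr0.
by apply: val_inj; rewrite (linearZ_LR val) (linear0 val) /= scalerA uvarM scale0r.
Qed.

Lemma split_syzygy (X : lmodType A) i : split_family unit X ->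
  exists T : finType, #|T| = (2 ^ i)%N /\ split_family T (syzygy X i).
Proof.
move=> spX; elim: i => [|i [T [cT spT]]].
  by exists unit; rewrite card_unit.
exists (T * bool)%type; rewrite card_prod card_bool cT expnSr; split=> //.
have [e [s [_ [es us _]]]] := split_syzygy1 spT.
by exists e, s.
Qed.

(** Following [eps] by the inclusion of the residue field at [s] gives [2 ^ i.+1] cocycles.
    Evaluation at lifts of the [sigma], followed by [g], kills coboundaries, because the
    differential of such a lift is a multiple of some [uvar b], and it pairs these cocycles to the
    identity matrix. The factor 14 turns generators over [A] into a spanning set over [F]. *)
Lemma ext_generated_lower (X M : lmodType A) (s : M) (g : M -> F) i n :
    split_family unit X ->
    (forall a, aug a = 0 -> a *: s = 0) ->
    (forall a x y, g (scal a *: x + y) = a * g x + g y) ->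
    (forall b x, g (uvar b *: x) = 0) -> g s = 1 ->
  generated_by n (ext i.+1 X M) -> (2 ^ i.+1 <= n * 14)%N.
Proof.
move=> spX ms glin gu gs; rewrite gen_extP => -[z [zZ zgen]].
have [T [cT spT]] := split_syzygy i spX.
have [eps [sigma [f [es us sf]]]] := split_syzygy1 spT.
have g0 : g 0 = 0 by have := glin (-1) 0 0; rewrite scaler0 addr0; lra.
have gD x y : g (x + y) = g x + g y.
  by have := glin 1 x y; rewrite scal1 scale1r mul1r.
have gZ a x : g (scal a *: x) = a * g x by have := glin a x 0; rewrite g0 !addr0.
have gB x y : g (x - y) = g x - g y.
  by have := gZ (-1) y; rewrite scalN scal1 scaleN1r mulN1r => <-; apply: gD.
have socZ (a : A) : a *: s = scal (aug a) *: s.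
  apply/eqP; rewrite -subr_eq0 -scalerBl; apply/eqP/ms.
  by rewrite augD augN aug_scal subrr.
pose incl (x : resf) : M := scal x *: s.
have incllin : linear incl.
  move=> a x y; rewrite /incl scalD scalerDl resf_scaleE scalM -scalerA.
  by rewrite scalerA mulrC -scalerA -socZ scalerA mulrC -scalerA.
pose Incl : {linear resf -> M} :=
  HB.pack incl (GRing.isLinear.Build A resf M *:%R incl incllin).
pose P := std_resolution X.
pose phi tb : Defs.hom (res_mod P i.+1) M :=
  Incl \o (eps tb \o eval_cover (syzygy X i.+1)).
have phiE tb x : phi tb x = Incl (eps tb (eval_cover (syzygy X i.+1) x)) by [].
have /choice[p pP] tb := @eval_cover_surj A (syzygy X i.+1) (sigma tb).
have phiZ tb : phi tb \in @cocycle A X M P i.+1.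
  apply/cocycleP => x; rewrite phiE.
  have -> : eval_cover (syzygy X i.+1) (res_diff P i.+1 x) = 0.
    by apply/std_exact; exists x.
  by rewrite !linear0.
have ev_cob (h : Defs.hom (res_mod P i.+1) M) tb : coboundary h -> g (h (p tb)) = 0.
  move=> [k ->]; rewrite -[res_diff _ _ _]/(val (eval_cover _ (p tb))) pP sf.
  by rewrite linearZ gu.
have /choice[r rP] tb := zgen _ (phiZ tb).
have [b bP] := spanned_alg F.
have /choice[d dP] (tbk : (T * bool) * 'I_n) : exists d : 'I_14 -> F,
    r tbk.1 tbk.2 = \sum_j scal (d j) * (b j : A) by apply: bP.
pose I : finType := (T * bool)%type; pose J : finType := ('I_n * 'I_14)%type.
pose G := \matrix_(j < #|J|, i < #|I|)
  g ((b (enum_val j).2 : A) *: z (enum_val j).1 (p (enum_val i))).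
pose Q := \matrix_(i < #|I|, j < #|J|)
  d (enum_val i, (enum_val j).1) (enum_val j).2.
(* The identity matrix of size [2 ^ i.+1] factors through dimension [n * 14], so comparing ranks
   gives the bound. *)
suff QG : Q *m G = 1%:M.
  have := mxrankM_maxl Q G; rewrite QG mxrank1.
  move=> /leq_trans/(_ (rank_leq_col _)).
  by rewrite !card_prod card_bool cT !card_ord expnSr.
apply/matrixP => i1 i2; rewrite !mxE.
set t1 := enum_val i1; set t2 := enum_val i2.
have -> : (i1 == i2) = (t1 == t2) by rewrite (inj_eq enum_val_inj).
have := ev_cob _ t2 (rP t1).
have homsum (K : finType) (H : K -> Defs.hom (res_mod P i.+1) M) x :
  (\sum_j H j : Defs.hom (res_mod P i.+1) M) x = \sum_j H j x.
  by elim/big_rec2: _ => [|j u v _ <-].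
rewrite [X in g X](_ : _ = phi t1 (p t2) - \sum_k r t1 k *: z k (p t2)); last first.
  transitivity (phi t1 (p t2) -
    (\sum_k r t1 k *: z k : Defs.hom (res_mod P i.+1) M) (p t2)); first by [].
  by rewrite homsum.
rewrite gB => /eqP; rewrite subr_eq0 => /eqP gE.
transitivity (g (phi t1 (p t2))); last first.
  by rewrite phiE pP es -[Incl _]/(scal _ *: s) gZ gs mulr1.
rewrite gE (big_morph g gD g0).
transitivity (\sum_k \sum_j d (t1, k) j * g ((b j : A) *: z k (p t2))); last first.
  apply: eq_bigr => k _; rewrite (dP (t1, k)) scaler_suml (big_morph g gD g0).
  by apply: eq_bigr => j _; rewrite -scalerA gZ.
rewrite pair_bigA /=.
rewrite [RHS](reindex (@enum_val _ (mem J))); last exact/onW_bij/enum_val_bij.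
by apply: eq_bigr => j _; rewrite !mxE.
Qed.

End LowerBound.

(** * The modules *)

Section Matrices.
Variable F : realFieldType.
Local Notation A := (alg F).

Definition x1 : A := (0, (1, 0, 0, 0, 0, 0), vzero F, 0).
Definition x2 : A := (0, (0, 1, 0, 0, 0, 0), vzero F, 0).
Definition x3 : A := (0, (0, 0, 1, 0, 0, 0), vzero F, 0).
Definition x4 : A := (0, (0, 0, 0, 1, 0, 0), vzero F, 0).

Definition pair2 : lmodType A := (A^o * A^o)%type.

Definition mx2 (a b c d : A) (x : pair2) : pair2 :=
  (a * x.1 + b * x.2, c * x.1 + d * x.2).
Fact mx2_linear a b c d : linear (mx2 a b c d).
Proof.
by move=> k [p q] [p' q']; congr pair; rewrite /= /GRing.scale /=; ring.
Qed.
HB.instance Definition _ a b c d :=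
  GRing.isLinear.Build A pair2 pair2 *:%R (mx2 a b c d) (mx2_linear a b c d).

Definition Dmap (l : F) : {linear pair2 -> pair2} := mx2 x1 (scal l * x3) x4 x2.
(** The transpose of [Dmap l]. *)
Definition Emap (l : F) : {linear pair2 -> pair2} := mx2 x1 x4 (scal l * x3) x2.

Section Coordinates.
Variables (l p0 p1 p2 p3 p4 p5 p6 v1 v2 v3 v4 v5 v6 p7 : F).
Variables (q0 q1 q2 q3 q4 q5 q6 w1 w2 w3 w4 w5 w6 q7 : F).
Let P : A := (p0, (p1, p2, p3, p4, p5, p6), (v1, v2, v3, v4, v5, v6), p7).
Let Q : A := (q0, (q1, q2, q3, q4, q5, q6), (w1, w2, w3, w4, w5, w6), q7).

Lemma DmapE : Dmap l (P, Q) =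
  ((0, (p0, 0, l * q0, 0, 0, 0),
    (l * q5, p6 - 2 * l * q5, p5 + l * q3, p5 + p4, p3 + p4 + l * (q1 - 2 * q2), p2),
    v1 + l * w3),
   (0, (0, q0, 0, p0, 0, 0),
    (p5 + p4 + q6, - (p5 + p4), - 2 * q5, p1 - p2 - 2 * p4 - q5 - q4,
     p1 - p2 - 2 * q3 - q4, q1), v4 + w2)).
Proof.
have -> : Dmap l (P, Q) = ((x1 * P + scal l * x3 * Q, x4 * P + x2 * Q) : A * A).
  by [].
rewrite /x1 /x2 /x3 /x4 /P /Q !mulE !addE /scal.
by congr pair; alg_ring.
Qed.

Lemma EmapE : Emap l (P, Q) =
  ((0, (p0, 0, 0, q0, 0, 0),
    (q5 + q4, p6 - (q5 + q4), p5, p5 + p4 + q1 - q2 - 2 * q4,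
     p3 + p4 + q1 - q2, p2), v1 + w4),
   (0, (0, q0, l * p0, 0, 0, 0),
    (l * p5 + q6, - 2 * l * p5, l * p3 - 2 * q5, - (q5 + q4),
     l * (p1 - 2 * p2) - 2 * q3 - q4, q1), l * v3 + w2)).
Proof.
have -> : Emap l (P, Q) = ((x1 * P + x4 * Q, scal l * x3 * P + x2 * Q) : A * A).
  by [].
rewrite /x1 /x2 /x3 /x4 /P /Q !mulE !addE /scal.
by congr pair; alg_ring.
Qed.

End Coordinates.

(** The two equations say that [Dmap (l / 2)] kills the degree 2 part. The statement includes
    [l = 2], where that next map is the exceptional [Dmap 1]. *)
Lemma Dmap_image_deg2 l v1 v2 v3 v4 v5 v6 p7 w1 w2 w3 w4 w5 w6 q7 :
    l != 1 -> v1 + l / 2 * w3 = 0 -> v4 + w2 = 0 ->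
  exists x, Dmap l x =
    ((0, vzero F, (v1, v2, v3, v4, v5, v6), p7),
     (0, vzero F, (w1, w2, w3, w4, w5, w6), q7)).
Proof.
move=> l1 vw3 vw2; have l1' : 1 - l != 0 by rewrite subr_eq0 eq_sym.
pose s5 := - w3 / 2.
(* Subtracting the fifth from the fourth degree 2 coordinate of the second component and eliminating
   the other unknowns leaves an equation for [q3] with coefficient [2 * (1 - l)]. *)
pose s3 := (w4 - w5 + 2 * v4 - 2 * v3 + s5) / (2 * (1 - l)).
have s3E : s3 * (2 * (1 - l)) = w4 - w5 + 2 * v4 - 2 * v3 + s5.
  by rewrite mulfVK // mulf_neq0 // pnatr_eq0.
pose r5 := v3 - l * s3; pose r4 := v4 - r5; pose r1 := w5 + v6 + 2 * s3.
exists ((0, (r1, v6, v5 - r4 - l * w6, r4, r5, v2 + 2 * l * s5),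
         (p7, 0, 0, 0, 0, 0), 0) : A,
        (0, (w6, 0, s3, 0, s5, w1 - v4), (0, q7, 0, 0, 0, 0), 0) : A).
rewrite DmapE /vzero.
have l5 : l * s5 = v1 by rewrite /s5; lra.
rewrite /r1 /r4 /r5; clearbody s3.
by congr pair; repeat congr pair; rewrite ?l5; rewrite /s5 in s3E *; lra.
Qed.

(** Here the two equations say that [Emap (2 * l)] kills the degree 2 part. *)
Lemma Emap_image_deg2 l v1 v2 v3 v4 v5 v6 p7 w1 w2 w3 w4 w5 w6 q7 :
    l != 0 -> l != 1 -> v1 + w4 = 0 -> 2 * l * v3 + w2 = 0 ->
  exists x, Emap l x =
    ((0, vzero F, (v1, v2, v3, v4, v5, v6), p7),
     (0, vzero F, (w1, w2, w3, w4, w5, w6), q7)).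
Proof.
move=> l0 l1 vw vw2; have l1' : 1 - l != 0 by rewrite subr_eq0 eq_sym.
pose s4 := (w3 + 2 * v1 - l * (v3 - v4 + v5)) / (2 * (1 - l)).
have s4E : s4 * (2 * (1 - l)) = w3 + 2 * v1 - l * (v3 - v4 + v5).
  by rewrite mulfVK // mulf_neq0 // pnatr_eq0.
pose r3 := v3 - 2 * s4 - v4 + v5; pose r4 := v5 - r3 - w6.
exists ((0, (0, v6, r3, r4, v3, v2 + v1), (p7, 0, 0, 0, 0, 0), 0) : A,
        (0, (w6, 0, - (w5 + 2 * l * v6 + s4) / 2, s4, v1 - s4, w1 - l * v3),
          (0, q7, 0, 0, 0, 0), 0) : A).
rewrite EmapE /vzero.
rewrite /r4 /r3; clearbody s4.
by congr pair; repeat congr pair; lra.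
Qed.

(** The matrix product vanishes by the relations x1^2 = x2^2 = x3 x4 = 0, x2 x3 = -2 x1 x3 and x2 x4
    = -x1 x4. The third one forces the parameter to double. *)
Lemma Dmap_comp l x : Dmap l (Dmap (2 * l) x) = 0.
Proof.
case: x => P Q; alg_intro P; alg_intro Q; rewrite !DmapE.
have -> : (0 : pair2) = (alg_zero F, alg_zero F) by [].
by rewrite /alg_zero /vzero; congr pair; repeat congr pair; ring.
Qed.

Lemma Emap_comp l x : Emap (2 * l) (Emap l x) = 0.
Proof.
case: x => P Q; alg_intro P; alg_intro Q; rewrite !EmapE.
have -> : (0 : pair2) = (alg_zero F, alg_zero F) by [].
by rewrite /alg_zero /vzero; congr pair; repeat congr pair; ring.
Qed.

(* At [l = 1] the kernel of [Dmap l] has one more element in degree 1, found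
   by taking [q3 = 1] below; it reappears in [split_socle_Mmod]. *)
Lemma Dmap_exact l : l != 0 -> l != 1 -> 2 * l != 1 -> exact_at (Dmap (2 * l)) (Dmap l).
Proof.
move=> l0 l1 l21 y; split=> [|[x <-]]; last exact: Dmap_comp.
case: y => -[[[p0 [[[[[p1 p2] p3] p4] p5] p6]] [[[[[v1 v2] v3] v4] v5] v6]] p7].
move=> [[[q0 [[[[[q1 q2] q3] q4] q5] q6]] [[[[[w1 w2] w3] w4] w5] w6]] q7].
rewrite DmapE.
have -> : (0 : pair2) = (alg_zero F, alg_zero F) by [].
rewrite /alg_zero /vzero => -[] p00 lq0 lq5 e2 e3 e4 e5 p20 e7 q00 _ e10 e11 e12 e13 e14 q10 e15.

have q50 : q5 = 0 by apply: (mulfI l0); rewrite lq5 mulr0.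
have p6E : p6 = 0 by rewrite q50 in e2; lra.
have q6E : q6 = 0 by lra.
have p5E : p5 = - l * q3 by lra.
have p4E : p4 = l * q3 by lra.
have q3E : q3 = 0.
  have l1' : 1 - l != 0 by rewrite subr_eq0 eq_sym.
  by apply: (mulIf l1'); rewrite mul0r; lra.
rewrite q3E mulr0 in p4E; rewrite q3E mulr0 in p5E.
have p1E : p1 = q4 by lra.
have p3E : p3 = 2 * l * q2 by rewrite q10 in e5; lra.
have [|||x xE] := @Dmap_image_deg2 (2 * l) v1 v2 v3 v4 v5 v6 p7 w1 w2 w3 w4 w5 w6 q7.
- exact: l21.
- lra.
- lra.
(* The constants account for the degree 1 part of the cycle, and [x] for degrees 2 and 3. *)
exists (x + (scal p1, scal q2)); rewrite linearD xE.
rewrite [X in _ + X](_ : _ = Dmap (2 * l) ((p1, (0,0,0,0,0,0), (0,0,0,0,0,0), 0) : A,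
  (q2, (0,0,0,0,0,0), (0,0,0,0,0,0), 0) : A)) // DmapE.
rewrite /scal /vzero.
rewrite p00 q00 p20 q10 p4E p5E p6E q50 q6E q3E p3E -p1E.
rewrite -[LHS]/(alg_add _ _, alg_add _ _) /alg_add /vadd.
by congr pair; repeat congr pair; ring.
Qed.

(** Kept apart from exactness because the case [l = 2] also yields the linearity of [eta] in
    [split_family_Kmod]. *)
Lemma Emap_kernel_deg1 l p0 p1 p2 p3 p4 p5 p6 v1 v2 v3 v4 v5 v6 p7
    q0 q1 q2 q3 q4 q5 q6 w1 w2 w3 w4 w5 w6 q7 :
  l != 0 -> l != 1 ->
  Emap l ((p0, (p1, p2, p3, p4, p5, p6), (v1, v2, v3, v4, v5, v6), p7) : A,
    (q0, (q1, q2, q3, q4, q5, q6), (w1, w2, w3, w4, w5, w6), q7) : A) = 0 ->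
  [/\ [/\ p0 = 0, p2 = 0, p3 = 0, p4 = q2 & p5 = 0 /\ p6 = 0],
      [/\ q0 = 0, q1 = 0, 2 * q3 = l * p1, q4 = 0 & q5 = 0 /\ q6 = 0]
    & v1 + w4 = 0 /\ l * v3 + w2 = 0].
Proof.
move=> l0 l1; rewrite EmapE.
have -> : (0 : pair2) = (alg_zero F, alg_zero F) by [].
rewrite /alg_zero /vzero => -[] p00 q00 e1 e2 e3 e4 e5 p20 e7 q00' lp0 e9 e10 e11 e12 e13 q10 e15.
have q4E : q4 = 0.
  have l1' : 1 - l != 0 by rewrite subr_eq0 eq_sym.
  apply: (mulIf l1'); rewrite mul0r.
  have p3E : p3 = - 2 * q4 by lra.
  by rewrite p3E in e11; lra.
have p5E : p5 = 0 by lra.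
rewrite p5E in e9.
rewrite p20 in e13.
by do !split; lra.
Qed.

Lemma Emap_exact l : l != 0 -> l != 1 -> 2 * l != 1 -> exact_at (Emap l) (Emap (2 * l)).
Proof.
move=> l0 l1 l21 y; split=> [|[x <-]]; last exact: Emap_comp.
case: y => -[[[p0 [[[[[p1 p2] p3] p4] p5] p6]] [[[[[v1 v2] v3] v4] v5] v6]] p7].
move=> [[[q0 [[[[[q1 q2] q3] q4] q5] q6]] [[[[[w1 w2] w3] w4] w5] w6]] q7].
have l20 : 2 * l != 0 by rewrite mulf_neq0 // pnatr_eq0.
move=> /(Emap_kernel_deg1 l20 l21)[[-> -> -> -> [-> ->]] [-> -> q3E -> [-> ->]] [vw vw2]].
have [x xE] := Emap_image_deg2 v2 v4 v5 v6 p7 w1 w3 w5 w6 q7 l0 l1 vw vw2.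
exists (x + (scal p1, scal q2)); rewrite linearD xE.
rewrite [X in _ + X](_ : _ = Emap l ((p1, (0,0,0,0,0,0), (0,0,0,0,0,0), 0) : A,
  (q2, (0,0,0,0,0,0), (0,0,0,0,0,0), 0) : A)) // EmapE.
have -> : q3 = l * p1 by lra.
rewrite -[LHS]/(alg_add _ _, alg_add _ _) /alg_add /vadd /vzero.
by congr pair; repeat congr pair; ring.
Qed.

End Matrices.

(** * From the two bounds to exponential growth *)

Section Growth.
Import Reals Lra ssrnat.
Local Open Scope R_scope.

Lemma INR_expn (n i : nat) : INR (n ^ i)%N = pow (INR n) i.
Proof. by elim: i => //= i IH; rewrite expnS mult_INR IH. Qed.

Lemma exponential_growth_between (c : nat -> nat) (C : nat) :
    (forall i, (2 ^ i.+1 <= c i.+1 * 14)%N) -> (forall i, (c i <= C * 14 ^ i)%N) ->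
  exponential_growth c.
Proof.
move=> lo up; have le_INR' m n : (m <= n)%N -> INR m <= INR n.
  by move=> /leP; apply: le_INR.
(* A base below 2 leaves the ratio [(4 / 3) ^ i], which absorbs the factor 14 from [i = 10] on. The
   summand 2 keeps the upper base above the lower one even for [C = 0]. *)
exists (3 / 2), (INR (14 * C + 2)); split.
- by Lra.lra.
- apply: (Rle_trans _ (INR 2)); first by rewrite /=; Lra.lra.
  by apply: le_INR'; rewrite leq_addl.
exists 10%N => i i10; have i0 : (0 < i)%N by apply: leq_trans i10.
split.
  have lo' : (2 ^ i <= c i * 14)%N by case: i i0 {i10} => // i _; apply: lo.
  have := le_INR' _ _ lo'; rewrite mult_INR INR_expn.
  have -> : INR 14 = 14 by rewrite /=; Lra.lra.
  have -> : INR 2 ^ i = (3 / 2) ^ i * (4 / 3) ^ i.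
    by rewrite -Rpow_mult_distr; congr (_ ^ _); rewrite /=; Lra.lra.
  have : (4 / 3) ^ 10 <= (4 / 3) ^ i by apply: Rle_pow; [Lra.lra | apply/leP].
  have : 14 <= (4 / 3) ^ 10 by rewrite /=; Lra.lra.
  have : 0 < (3 / 2) ^ i by apply: pow_lt; Lra.lra.
  by Lra.nra.
rewrite -INR_expn; apply: le_INR'; apply: leq_trans (up i) _.
case: C {up lo} => [|C]; first by rewrite mul0n.
apply: (@leq_trans ((14 * C.+1) ^ i)); last by rewrite leq_exp2r // leq_addr.
rewrite expnMn mulnC leq_mul2l; apply/orP; right.
by rewrite -{1}[C.+1]expn1 leq_pexp2l.
Qed.

End Growth.

(** * Computing the exact number of generators of Ext *)

Section Rank.
Variable F : realFieldType.
Local Notation A := (alg F).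

Definition has_rank d (X : lmodType A) :=
  generated_by d X /\ forall p, generated_by p X -> (d <= p)%N.

Lemma num_gens_rank d X : has_rank d X -> num_gens X = d.
Proof.
move=> [Xd dmin]; have [gens gmin] := num_gensP Xd.
by apply/eqP; rewrite eqn_leq gmin // dmin.
Qed.

(** [l] identifies the cohomology with [d] copies of the residue field. Semilinearity is asked on
    cocycles only: in [ext0_Kmod_rank] the socle coordinates are semilinear there because cocycles
    take values in the socle. *)
Lemma ext_has_rank d (M N : lmodType A) (P : proj_resolution M) i
    (l : Defs.hom (res_mod P i) N -> 'rV[F]_d) :
    (forall x y, l (x + y) = l x + l y) ->
    (forall a x, x \in @cocycle A M N P i -> l (a *: x) = aug a *: l x) ->
    (forall x, x \in @cocycle A M N P i -> (coboundary x <-> l x = 0)) ->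
    (forall x, coboundary x -> x \in @cocycle A M N P i) ->
    (forall v, exists x, x \in @cocycle A M N P i /\ l x = v) ->
  has_rank d (ext_of N P i).
Proof.
move=> lD lZ lB BZ lsurj.
have Zlin a x y : x \in @cocycle A M N P i -> y \in @cocycle A M N P i ->
    a *: x + y \in @cocycle A M N P i.
  move=> xZ yZ; have S := GRing.SubmodClosed.clone A _ (@cocycle A M N P i) _.
  exact: (rpredD (rpredZ a xZ) yZ).
have l0 : l 0 = 0 by apply: (addrI (l 0)); rewrite -lD !addr0.
have lN x : l (- x) = - l x by apply: (addrI (l x)); rewrite -lD !subrr.
have lsum n (c : 'I_n -> A) z : (forall k, z k \in @cocycle A M N P i) ->
    l (\sum_k c k *: z k) = \sum_k aug (c k) *: l (z k).
  by move=> zZ; rewrite (big_morph l lD l0); apply: eq_bigr => k _; rewrite lZ.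
split=> [|p]; rewrite gen_extP.
  have /choice[z zP] k := lsurj (row k 1%:M); exists z.
  split=> [k|f fZ]; first by case: (zP k).
  exists (fun k => scal (l f 0 k)).
  have sZ : \sum_k scal (l f 0 k) *: z k \in @cocycle A M N P i.
    elim/big_ind: _ => [|x y xZ yZ|k _].
    - by apply: BZ; apply: coboundary0.
    - by rewrite -[x]scale1r Zlin.
    - by rewrite -[_ *: _]addr0 Zlin //; [case: (zP k) | apply/BZ/coboundary0].
  apply/lB; first by rewrite addrC -scaleN1r Zlin.
  rewrite lD lN lsum; last by move=> k; case: (zP k).
  apply/eqP; rewrite subr_eq0; apply/eqP/rowP => j; rewrite summxE (bigD1 j) //=.
  rewrite big1 ?addr0 ?aug_scal ?(zP _).2 ?mxE ?eqxx ?mulr1 // => k kj.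
  by rewrite (zP _).2 !mxE (negbTE kj) mulr0.
move=> [z [zZ zgen]]; pose G := \matrix_(k < p) l (z k).
suff : row_full G by move=> /eqP <-; apply: rank_leq_row.
rewrite -sub1mx; apply/row_subP => k; have [f [fZ <-]] := lsurj (row k 1%:M).
have [c fc] := zgen f fZ.
have /eqP := (lB _ (BZ _ fc)).1 fc; rewrite lD lN subr_eq0 lsum // => /eqP ->.
apply: summx_sub => j _; apply: scalemx_sub.
by rewrite (_ : l (z j) = row j G) ?row_sub // rowK.
Qed.

Lemma has_rank_eq d (X Y : lmodType A) :
  (forall n, generated_by n X <-> generated_by n Y) -> has_rank d X -> has_rank d Y.
Proof. by move=> XY [Xd dmin]; split=> [|p /XY]; [apply/XY | apply: dmin]. Qed.

Local Notation k := (residue_field (max_ideal F)).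

Lemma residue_iso : exists r : {linear k -> resf F},
  (forall a, r (quotmod_pi (max_ideal F) a) = aug (a : A)) /\ injective r.
Proof.
pose aug' (x : A^o) : resf F := aug x.
have auglin : linear aug' by move=> a x y; rewrite /aug' augD augM.
pose g : {linear A^o -> resf F} :=
  HB.pack aug' (GRing.isLinear.Build A A^o (resf F) *:%R aug' auglin).
have [x|r rE] := @quotmod_lift A A^o (resf F) (max_ideal F) g.
  by rewrite in_max_ideal => /eqP.
exists r; split=> // u v uv; have [x xE] := quotmod_pi_surj (u - v).
apply/eqP; rewrite -subr_eq0 xE; apply/eqP/quotmod_pi_eq0; rewrite in_max_ideal.
have <- : r (quotmod_pi (max_ideal F) x) = aug x by apply: rE.
by rewrite /quotmod_pi -xE linearB uv subrr.
Qed.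

(** If [max_ideal] kills [x], the pairing of [x] with [z] depends on [aug z] alone, as it does for a
    multiple of the socle generator. *)
Lemma socle_alg (x : A) : (forall a : A, aug a = 0 -> a * x = 0) ->
  x = (0, vzero F, vzero F, deg3 x).
Proof.
move=> xm; apply: deg3_inj => z.
have z0 : aug (z - scal (aug z)) = 0 by rewrite augD augN aug_scal subrr.
have := xm _ z0; rewrite mulrBl => /eqP; rewrite subr_eq0 => /eqP ->.
move: z x {xm z0} => [[[z0 [[[[[z1 z2] z3] z4] z5] z6]] [[[[[y1 y2] y3] y4] y5] y6]] z7].
move=> [[[x0 [[[[[x1 x2] x3] x4] x5] x6]] [[[[[w1 w2] w3] w4] w5] w6]] x7].
by rewrite !mulE /scal /alg_mul /deg3 /aug /vzero /=; ring.
Qed.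

Lemma residue_kill (a : A) (x : k) : aug a = 0 -> a *: x = 0.
Proof.
move=> a0; have [r [_ rinj]] := residue_iso; apply: rinj.
by rewrite linearZ linear0 /= resf_scaleE a0 mul0r.
Qed.

End Rank.

(** * The cokernel [Mmod] and its Betti numbers *)

Section Examples.
Variable F : realFieldType.
Local Notation A := (alg F).
Local Notation mI := (max_ideal F).
Local Notation k := (residue_field mI).
Local Notation pair2 := (pair2 F).

(** In an ordered field 2 has infinite multiplicative order, so the parameters never return to the
    exceptional value 1. *)
Lemma pow2_neq (i : nat) : (2 ^+ i.+1 : F) != 0 /\ (2 ^+ i.+1 : F) != 1.
Proof.
have h : (1 : F) < 2 ^+ i.+1 by rewrite exprn_egt1 // ltr1n.
by split; [rewrite gt_eqF // (lt_trans _ h) // ltr01 | rewrite gt_eqF].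
Qed.

Lemma Dmap_pow_exact i : exact_at (Dmap (2 ^+ i.+2 : F)) (Dmap (2 ^+ i.+1)).
Proof.
have [h0 h1] := pow2_neq i; have [_ h2] := pow2_neq i.+1.
by have := Dmap_exact h0 h1; rewrite -exprS; apply.
Qed.

Lemma Emap_pow_exact i : exact_at (Emap (2 ^+ i.+1 : F)) (Emap (2 ^+ i.+2)).
Proof.
have [h0 h1] := pow2_neq i; have [_ h2] := pow2_neq i.+1.
by have := Emap_exact h0 h1; rewrite -exprS; apply.
Qed.

Definition comb2 (N : lmodType A) (n1 n2 : N) (x : pair2) : N :=
  (x.1 : A) *: n1 + (x.2 : A) *: n2.
Fact comb2_linear (N : lmodType A) (n1 n2 : N) : linear (comb2 n1 n2).
Proof.
move=> a [p q] [p' q']; rewrite /comb2 /= !scalerDl !scalerDr !scalerA.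
by rewrite addrACA.
Qed.
HB.instance Definition _ (N : lmodType A) (n1 n2 : N) :=
  GRing.isLinear.Build A pair2 N *:%R (comb2 n1 n2) (comb2_linear n1 n2).

Lemma comb2_fst (N : lmodType A) (n1 n2 : N) : comb2 n1 n2 (1, 0) = n1.
Proof.
transitivity ((1 : A) *: n1 + (0 : A) *: n2); first by [].
by rewrite scale1r scale0r addr0.
Qed.

Lemma comb2_snd (N : lmodType A) (n1 n2 : N) : comb2 n1 n2 (0, 1) = n2.
Proof.
transitivity ((0 : A) *: n1 + (1 : A) *: n2); first by [].
by rewrite scale1r scale0r add0r.
Qed.

Lemma linear_pair2E (N : lmodType A) (f : {linear pair2 -> N}) x :
  f x = comb2 (f (1, 0)) (f (0, 1)) x.
Proof.
rewrite /comb2 -!linearZ -linearD; congr (f _); case: x => p q.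
by congr pair; rewrite /= /GRing.scale /= ?mulr1 ?mulr0 ?addr0 ?add0r.
Qed.

Lemma pair2_projective : projective_module pair2.
Proof.
move=> X Y g h gsurj; have [a aP] := gsurj (h (1, 0)); have [b bP] := gsurj (h (0, 1)).
exists (comb2 a b) => x; rewrite [RHS]linear_pair2E /comb2 linearD !linearZ /=.
by rewrite aP bP.
Qed.

Lemma pair2_injective : injective_module pair2.
Proof.
move=> X Y f g finj.
pose p1 (x : pair2) : A^o := x.1; pose p2 (x : pair2) : A^o := x.2.
have p1lin : linear p1 by []. have p2lin : linear p2 by [].
pose P1 : {linear pair2 -> A^o} := HB.pack p1 (GRing.isLinear.Build A pair2 A^o *:%R p1 p1lin).
pose P2 : {linear pair2 -> A^o} := HB.pack p2 (GRing.isLinear.Build A pair2 A^o *:%R p2 p2lin).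
have [h1 h1E] := @alg_self_injective F _ _ f (P1 \o g : {linear _ -> _}) finj.
have [h2 h2E] := @alg_self_injective F _ _ f (P2 \o g : {linear _ -> _}) finj.
pose h (y : Y) : pair2 := (h1 y, h2 y).
have hlin : linear h by move=> a u v; congr pair; rewrite /= linearP.
pose H : {linear Y -> pair2} := HB.pack h (GRing.isLinear.Build A Y pair2 *:%R h hlin).
exists H => x; rewrite -[H _]/(h _).
by rewrite /h h1E h2E /= /p1 /p2; case: (g x).
Qed.

Definition Mmod : lmodType A :=
  quotmod (GRing.SubmodClosed.clone A _ (lin_image (Dmap (2 : F))) _).

Definition Mpi : {linear pair2 -> Mmod} := @quotmod_pi _ _ _.

Lemma Mpi_surj : Defs.surjective Mpi.
Proof. by move=> y; have [x ->] := quotmod_pi_surj y; exists x. Qed.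

Lemma Mpi_exact : exact_at (Dmap (2 ^+ 1 : F)) Mpi.
Proof.
move=> y; rewrite expr1; split=> [/quotmod_pi_eq0/lin_imageP //|yD].
by apply/quotmod_pi_eq0/lin_imageP.
Qed.

Definition Mres : proj_resolution Mmod :=
  @ProjResolution A Mmod (fun=> pair2) (fun i => Dmap (2 ^+ i.+1)) Mpi
    (fun=> pair2_projective) Mpi_surj Mpi_exact Dmap_pow_exact.

Lemma pair2_fin_gen : fin_gen pair2.
Proof.
exists 2%N, (fun i : 'I_2 => if i == 0 then (1, 0) else (0, 1)) => -[p q].
exists (fun i : 'I_2 => if i == 0 then p else q).
rewrite !big_ord_recl big_ord0 /= addr0.
by congr pair; rewrite /= /GRing.scale /= ?mulr1 ?mulr0 ?addr0 ?add0r.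
Qed.

Lemma fin_gen_surj (X Y : lmodType A) (f : {linear X -> Y}) :
  (forall y, exists x, f x = y) -> fin_gen X -> fin_gen Y.
Proof.
move=> fsurj [n [g gP]]; exists n, (f \o g) => y; have [x <-] := fsurj y.
have [c ->] := gP x; exists c; rewrite linear_sum; apply: eq_bigr => i _.
by rewrite linearZ.
Qed.

Lemma fin_gen_submod (X : lmodType A) (S : submodClosed X) :
  fin_gen X -> fin_gen (submod S).
Proof.
move=> [n /generated_spanned/spanned_ord sp].
exists #|{: 'I_n * 'I_14}|; apply: spanned_generated; apply: spanned_submod.
exact: sp.
Qed.

Lemma Mmod_fin_gen : fin_gen Mmod.
Proof. exact: fin_gen_surj Mpi_surj pair2_fin_gen. Qed.

Lemma residue_fin_gen : fin_gen k.
Proof.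
apply: (@fin_gen_surj A^o k (@quotmod_pi _ _ _)).
  by move=> y; have [x ->] := quotmod_pi_surj y; exists x.
by exists 1%N, (fun=> 1) => x; exists (fun=> x); rewrite big_ord1 /GRing.scale /= mulr1.
Qed.

Lemma comb2_max (N : lmodType A) (n1 n2 : N) (x : pair2) :
    (forall a : A, aug a = 0 -> a *: n1 = 0) -> (forall a : A, aug a = 0 -> a *: n2 = 0) ->
  aug (x.1 : A) = 0 -> aug (x.2 : A) = 0 -> comb2 n1 n2 x = 0.
Proof. by move=> n10 n20 x10 x20; rewrite /comb2 n10 // n20 // addr0. Qed.

Lemma Dmap_aug l (x : pair2) : aug ((Dmap l x).1 : A) = 0 /\ aug ((Dmap l x).2 : A) = 0.
Proof. by case: x => P Q; alg_intro P; alg_intro Q; rewrite DmapE. Qed.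

(** The resolution [Mres] is minimal: the entries of each [Dmap] lie in [max_ideal], so all
    differentials vanish on maps to the residue field. *)
Lemma betti_Mmod i : betti mI Mmod i = 2%N.
Proof.
apply: num_gens_rank.
apply: (has_rank_eq (X := ext_of k Mres i)).
  by move=> n; split; apply: ext_generated_resolution.
have [r [rE rinj]] := residue_iso F.
have cob0 (x : Defs.hom (res_mod Mres i) k) : coboundary x -> x = 0.
  case: i x => [//|i] x [g gE]; apply: hom_ext => y; rewrite gE linear_pair2E.
  have [y1 y2] := Dmap_aug (2 ^+ i.+1) y.
  by apply: comb2_max => // a a0; apply: residue_kill.
apply: (@ext_has_rank F 2 Mmod k Mres i (fun f : Defs.hom pair2 k =>
  \row_(j < 2) (if j == 0 then r (f (1, 0)) else r (f (0, 1))))).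
- move=> x y; apply/rowP => j; rewrite !mxE /=.
  by case: ifP => _; rewrite linearD.
- move=> a x _; apply/rowP => j; rewrite !mxE /=.
  by case: ifP => _; rewrite linearZ.
- move=> x xZ; split=> [/cob0 ->|/rowP x0].
    by apply/rowP => j; rewrite !mxE /= linear0; case: ifP.
  rewrite (_ : x = 0); first exact: coboundary0.
  apply: hom_ext => y; rewrite linear_pair2E /comb2.
  have := x0 0; have := x0 1; rewrite !mxE /= => x1 x2.
  have -> : x (1, 0) = 0 by apply: rinj; rewrite x2 linear0.
  have -> : x (0, 1) = 0 by apply: rinj; rewrite x1 linear0.
  by rewrite !scaler0 addr0.
- by move=> x /cob0 ->; apply/cocycleP.
- move=> v; pose e j := quotmod_pi mI (scal (v 0 j)).
  pose x : Defs.hom pair2 k := comb2 (e 0) (e 1).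
  have x1 : x (1, 0) = e 0 := comb2_fst _ _.
  have x2 : x (0, 1) = e 1 := comb2_snd _ _.
  exists x; split.
    apply/cocycleP => y; have [y1 y2] := Dmap_aug (2 ^+ i.+1) y.
    by apply: comb2_max => // a a0; apply: residue_kill.
  apply/rowP => j; rewrite mxE x1 x2 !rE.
  have [->//|j0] := eqVneq j 0; have -> : j = 1 by apply/val_inj; case: j j0 => -[|[]].
  by [].
Qed.

End Examples.

(** * The kernels [Kmod] and their Bass numbers *)

Section Coresolution.
Variable F : realFieldType.
Local Notation A := (alg F).
Local Notation mI := (max_ideal F).
Local Notation k := (residue_field mI).
Local Notation pair2 := (pair2 F).

(** By exactness of the [Emap] sequence these are the successive cosyzygies of [Kmod 0] in free
    modules of rank 2. *)
Definition Kmod j : lmodType A :=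
  submod (GRing.SubmodClosed.clone A _ (Defs.kernel (Emap (2 ^+ j.+1 : F))) _).

Definition Kval j : {linear Kmod j -> pair2} := (val : Kmod j -> pair2).

Lemma Kval_inj j : injective (Kval j). Proof. exact: val_inj. Qed.

Lemma Kval_Emap j (x : Kmod j) : Emap (2 ^+ j.+1) (Kval j x) = 0.
Proof. by apply/eqP; exact: (valP x). Qed.

Lemma Kval_surj j (y : pair2) : Emap (2 ^+ j.+1) y = 0 -> exists x, Kval j x = y.
Proof.
move=> y0; have yK : y \in Defs.kernel (Emap (2 ^+ j.+1 : F)) by apply/eqP.
by exists (Submod yK : Kmod j).
Qed.

Lemma Kpi_exists j : exists pi : {linear pair2 -> Kmod j.+1},
  forall x, Kval j.+1 (pi x) = Emap (2 ^+ j.+1) x.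
Proof.
apply: factor_through_inj; first exact: Kval_inj.
by move=> x; apply: Kval_surj; apply/Emap_pow_exact; exists x.
Qed.

Lemma socle_pair2 (x : pair2) : (forall a : A, aug a = 0 -> a *: x = 0) ->
  x = ((0, vzero F, vzero F, deg3 (x.1 : A)), (0, vzero F, vzero F, deg3 (x.2 : A))).
Proof.
move=> x0; rewrite [x in LHS]surjective_pairing; congr pair; apply: socle_alg => a a0.
  by have := congr1 fst (x0 a a0).
by have := congr1 snd (x0 a a0).
Qed.

Lemma Emap_socle l (s t : F) :
  Emap l ((0, vzero F, vzero F, s) : A, (0, vzero F, vzero F, t) : A) = 0.
Proof.
rewrite EmapE; have -> : (0 : pair2) = (alg_zero F, alg_zero F) by [].
by rewrite /alg_zero /vzero; congr pair; repeat congr pair; ring.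
Qed.

Variable P : proj_resolution k.

Lemma cocycle0_factor (N : lmodType A) (f : Defs.hom (res_mod P 0) N) :
  f \in @cocycle A k N P 0 ->
  exists g : {linear k -> N}, forall x, g (res_aug P x) = f x.
Proof.
move=> /cocycleP f0; apply: factor_through_surj; first exact: res_aug_surj.
by move=> x /res_exact0[y <-]; apply: f0.
Qed.

Lemma cocycle0_max (N : lmodType A) (f : Defs.hom (res_mod P 0) N) x (a : A) :
  f \in @cocycle A k N P 0 -> aug a = 0 -> a *: f x = 0.
Proof.
by move=> /cocycle0_factor[g gE] a0; rewrite -gE -linearZ residue_kill // linear0.
Qed.

(** Shift along [0 -> Kmod j -> pair2 -> Kmod j.+1 -> 0]. It is valid in degree 0 too: a map from
    the residue field to [pair2] lands in the socle, which [Emap] kills. *)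
Lemma ext_Kmod_shift j i n :
  generated_by n (ext_of (Kmod j.+1) P i) <-> generated_by n (ext_of (Kmod j) P i.+1).
Proof.
have [pi piE] := Kpi_exists j.
apply: (ext_shift (iota := Kval j) (pi := pi)).
- exact: Kval_inj.
- move=> y; have [x xE] := (@Emap_pow_exact F j (Kval j.+1 y)).1 (Kval_Emap y).
  by exists x; apply: Kval_inj; rewrite piE.
- move=> y; split=> [y0|[x <-]]; last first.
    by apply: Kval_inj; rewrite piE Kval_Emap linear0.
  by apply: Kval_surj; rewrite -piE y0 linear0.
- case: i => [|i] f fZ.
    apply: hom_ext => x; apply: Kval_inj; rewrite linear0 piE.
    have -> := @socle_pair2 (f x) (fun a => cocycle0_max x fZ (a := a)).
    exact: Emap_socle.
  have [g gE] := injective_cocycle (@pair2_injective F) fZ.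
  by exists (hom_comp pi g) => x; rewrite /= gE.
- by move=> f; apply: injective_cocycle; apply: pair2_injective.
Qed.

(** Hom from the residue field is the socle of [Kmod j], which is the whole socle of [pair2]. *)
Lemma ext0_Kmod_rank j : has_rank 2 (ext_of (Kmod j) P 0).
Proof.
have [r [rE rinj]] := residue_iso F.
have [p pE] := @res_aug_surj A k P (quotmod_pi mI 1).
pose l (f : Defs.hom (res_mod P 0) (Kmod j)) : 'rV[F]_2 :=
  \row_(t < 2) (if t == 0 then deg3 ((Kval j (f p)).1 : A)
                else deg3 ((Kval j (f p)).2 : A)).
have deg3D (x y : A) : deg3 (x + y) = deg3 x + deg3 y.
  by rewrite addE; alg_intro x; alg_intro y.
have soc f : f \in @cocycle A k (Kmod j) P 0 -> Kval j (f p) =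
    ((0, vzero F, vzero F, deg3 ((Kval j (f p)).1 : A)),
     (0, vzero F, vzero F, deg3 ((Kval j (f p)).2 : A))).
  move=> fZ; apply: socle_pair2 => a a0.
  by rewrite -linearZ cocycle0_max // linear0.
have deg3M (a : A) s : deg3 (a * (0, vzero F, vzero F, s) : A) = aug a * s.
  by rewrite mulE; alg_intro a; rewrite /deg3 /aug /vzero /=; ring.
apply: (@ext_has_rank F 2 k (Kmod j) P 0 l).
- move=> x y; apply/rowP => t; rewrite !mxE.
  have -> : Kval j ((x + y) p) = Kval j (x p) + Kval j (y p) by rewrite -linearD.
  by case: ifP => _; apply: deg3D.
- move=> a x xZ; apply/rowP => t; rewrite !mxE.
  have -> : Kval j ((a *: x) p) = a *: Kval j (x p) by rewrite -linearZ.
  rewrite (soc _ xZ).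
  by case: ifP => _; apply: deg3M.
- move=> x xZ; split=> [->|/rowP x0].
    apply/rowP => t; rewrite !mxE.
    have -> : Kval j ((0 : Defs.hom (res_mod P 0) (Kmod j)) p) = 0.
      exact: linear0.
    by case: ifP.
  have xp : x p = 0.
    apply: Kval_inj; rewrite linear0 (soc _ xZ).
    by have := x0 0; have := x0 1; rewrite !mxE /= => -> ->.
  have [g gE] := cocycle0_factor xZ; apply: hom_ext => y.
  rewrite -gE; have [a ->] := quotmod_pi_surj (res_aug P y).
  have -> : \pi_(quotmod mI) a = (a : A) *: quotmod_pi mI 1.
    by rewrite -linearZ /quotmod_pi /GRing.scale /= mulr1.
  by rewrite linearZ_LR -pE gE xp; apply: scaler0.
- by move=> x ->; apply/cocycleP.
- move=> v.
  pose h (x : res_mod P 0) : pair2 := ((0, vzero F, vzero F, r (res_aug P x) * v 0 0) : A,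
    (0, vzero F, vzero F, r (res_aug P x) * v 0 1) : A).
  have hlin : linear h.
    move=> a x y; rewrite /h !linearP /=.
    rewrite -[RHS]/((a * _ + _ : A), (a * _ + _ : A)) !mulE !addE resf_scaleE.
    by alg_intro a; rewrite /aug /vzero /=; congr pair; repeat congr pair; ring.
  pose H : {linear res_mod P 0 -> pair2} :=
    HB.pack h (GRing.isLinear.Build A (res_mod P 0) pair2 *:%R h hlin).
  have [|x xE] := @factor_through_inj A _ _ _ (Kval j) H (@Kval_inj j).
    by move=> y; apply: Kval_surj; apply: Emap_socle.
  exists x; split.
    apply/cocycleP => y; apply: Kval_inj; rewrite xE linear0 -[H _]/(h _) /h.
    have -> : res_aug P (res_diff P 0 y) = 0 by apply/res_exact0; exists y.
    by rewrite linear0 !mul0r.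
  apply/rowP => t; rewrite mxE xE -[H p]/(h p) /h pE rE aug1 /deg3 /= !mul1r.
  have [->//|t0] := eqVneq t 0.
  have -> // : t = 1 by apply/val_inj; case: t t0 => -[|[]].
Qed.

Lemma ext_Kmod_rank j i : has_rank 2 (ext_of (Kmod j) P i).
Proof.
elim: i j => [|i IH] j; first exact: ext0_Kmod_rank.
exact: has_rank_eq (ext_Kmod_shift j i) (IH j.+1).
Qed.

End Coresolution.

(** * Split summands of the modules, growth and vanishing *)

Section Conclusion.
Variable F : realFieldType.
Local Notation A := (alg F).
Local Notation mI := (max_ideal F).
Local Notation k := (residue_field mI).
Local Notation pair2 := (pair2 F).

(* The counterpart of [split_family] in the second argument of Ext: [g] is linear
   only over the subring generated by [uvar]. *)
Definition split_socle (M : lmodType A) := exists (s : M) (g : M -> F),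
  [/\ forall a : A, aug a = 0 -> a *: s = 0,
      forall a x y, g (scal a *: x + y) = a * g x + g y,
      forall b x, g (uvar F b *: x) = 0 & g s = 1].

Lemma ext_exponential_growth (X M : lmodType A) :
    fin_gen X -> fin_gen M -> split_family unit X -> split_socle M ->
  exponential_growth (fun i => num_gens (ext i X M)).
Proof.
move=> Xfg Mfg spX [s [g [ms glin gu gs]]].
have [C CP] := ext_generated_upper Xfg Mfg.
apply: (@exponential_growth_between _ C) => i; have [gen gmin] := num_gensP (CP i).
  have [gen' _] := num_gensP (CP i.+1).
  exact: ext_generated_lower spX ms glin gu gs gen'.
exact: gmin (CP i).
Qed.

Lemma ext_nonzero (X M : lmodType A) i :
  split_family unit X -> split_socle M -> ~ zero_module (ext i.+1 X M).
Proof.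
move=> spX [s [g [ms glin gu gs]]] /generated_by0.
move=> /(ext_generated_lower spX ms glin gu gs).
by rewrite leqNgt expn_gt0.
Qed.

Lemma split_family_residue : split_family unit k.
Proof.
have [r [rE _]] := residue_iso F.
exists (fun=> r), (fun=> quotmod_pi mI 1); split=> [[] []|_ b].
  by rewrite rE aug1.
exact/residue_kill/aug_uvar.
Qed.

Lemma split_socle_residue : split_socle k.
Proof.
have [r [rE _]] := residue_iso F; exists (quotmod_pi mI 1), r; split.
- by move=> a a0; apply: residue_kill.
- by move=> a x y; rewrite linearP resf_scaleE aug_scal.
- by move=> b x; rewrite linearZ /= resf_scaleE aug_uvar mul0r.
- by rewrite rE aug1.
Qed.

Definition Nmod : lmodType A := dualnum ((1, 1, 0, 0, 0, 0) : vec F).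

Lemma Nmod_fin_gen : fin_gen Nmod.
Proof.
exists 2%N, (fun i : 'I_2 => if i == 0 then (1, 0) else (0, 1) : Nmod) => -[x y].
exists (fun i : 'I_2 => if i == 0 then scal x else scal y).
rewrite !big_ord_recl big_ord0 addr0 /=.
have sE (a p q : F) : scal a *: ((p, q) : Nmod) = (a * p, a * q) :> F * F.
  rewrite dualnum_scaleE; congr pair.
  by rewrite /slope /deg1 /scal /aug /dot /vzero /=; ring.
by rewrite !sE; congr pair; rewrite /=; ring.
Qed.

Lemma split_family_Nmod : split_family unit Nmod.
Proof.
exists (fun=> @dualnum_fst F _), (fun=> (1, 0)); split=> [[] []|_ b] //.
rewrite dualnum_scaleE uvarE.
by case: b; rewrite /slope /deg1 /aug /dot /=; congr pair; ring.
Qed.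

Lemma Nmod_scaleE (a : A) (x : Nmod) :
  a *: x = (aug a * x.1, aug a * x.2 + slope (1, 1, 0, 0, 0, 0) a * x.1) :> F * F.
Proof. by []. Qed.

Lemma comb2_Dmap_Nmod (n1 n2 : Nmod) l (x : pair2) :
  comb2 n1 n2 (Dmap l x) = (0, aug (x.1 : A) * n1.1 + aug (x.2 : A) * n2.1) :> F * F.
Proof.
case: x => P Q; have -> : comb2 n1 n2 (Dmap l (P, Q)) =
    ((Dmap l (P, Q)).1 : A) *: n1 + ((Dmap l (P, Q)).2 : A) *: n2 by [].
rewrite !Nmod_scaleE; alg_intro P; alg_intro Q; rewrite DmapE.
by rewrite /slope /deg1 /aug /dot /=; congr pair; rewrite /=; ring.
Qed.

Lemma comb2_NmodE (a b c d : F) (x : pair2) :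
  comb2 ((a, b) : Nmod) (c, d) x =
  (aug (x.1 : A) * a + aug (x.2 : A) * c,
   aug (x.1 : A) * b + slope (1, 1, 0, 0, 0, 0) (x.1 : A) * a
   + (aug (x.2 : A) * d + slope (1, 1, 0, 0, 0, 0) (x.2 : A) * c)) :> F * F.
Proof. by []. Qed.

(** Every differential of Hom(Mres, N) is multiplication by [t] on [N^2], and the kernel and image
    of [t] on [N] coincide. *)
Lemma ext_Mmod_Nmod i : zero_module (ext i.+1 (Mmod F) Nmod).
Proof.
apply/generated_by0/(ext_generated_resolution (P := Mres F)); rewrite gen_extP.
exists (fun=> 0); split=> [[] //|f /cocycleP f0]; exists (fun=> 0).
rewrite big_ord0 subr0.
have fE x : f x = comb2 (f (1, 0)) (f (0, 1)) x by apply: linear_pair2E.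
move: (f (1, 0)) (f (0, 1)) fE => [a b] [c d] fE.
have f0' (x : pair2) : aug (x.1 : A) * a + aug (x.2 : A) * c = 0.
  have := f0 x; rewrite fE comb2_Dmap_Nmod => /(congr1 snd); exact.
have a0 : a = 0.
  have := f0' (1, 0); rewrite -[aug _]/(1 : F) -[X in _ + X * _]/(0 : F).
  by rewrite mul1r mul0r addr0.
have c0 : c = 0.
  have := f0' (0, 1); rewrite -[aug _]/(0 : F) -[X in _ + X * _]/(1 : F).
  by rewrite mul1r mul0r add0r.
exists (comb2 ((b, 0) : Nmod) (d, 0)) => x.
rewrite fE -[RHS]/(comb2 ((b, 0) : Nmod) (d, 0) (Dmap (2 ^+ i.+1) x)).
rewrite comb2_Dmap_Nmod comb2_NmodE a0 c0.
by congr pair; rewrite /=; ring.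
Qed.

Lemma split_family_Kmod : split_family unit (Kmod F 0).
Proof.
(* [eta] is the pairing with the socle element of [split_socle_Mmod]. *)
pose eta (x : pair2) : F := let: ((_, _, (v1, _, v3, v4, v5, _), _),
  (_, _, (_, _, w3, _, _, _), _)) := (x : A * A) in 2 * v1 - v3 + v4 - v5 + w3.
(* The extra generator of the kernel: [eta] is 1 on it, and x5 and x6 kill it because it is dual to
   x3. *)
pose gamma : pair2 := ((0 : A), (0, vzero F, (0, 0, 1, 0, 0, 0), 0) : A).
have [c cE] : exists c : Kmod F 0, Kval F 0 c = gamma.
  apply: Kval_surj; rewrite /gamma [(0 : A)]/(alg_zero F) EmapE.
  have -> : (0 : pair2) = (alg_zero F, alg_zero F) by [].
  by rewrite /alg_zero /vzero; congr pair; repeat congr pair; ring.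
(* [eta] reads only degree 2; it vanishes on products of [max_ideal] with the degree 1 part of the
   kernel, as the explicit form of that part shows. *)
have eta_lin (a : A) (x y : pair2) : Emap (2 ^+ 1) x = 0 ->
    eta (a *: x + y) = aug a * eta x + eta y.
  rewrite expr1; have n2 : (2 : F) != 0 by rewrite pnatr_eq0.
  have n21 : (2 : F) != 1 := (pow2_neq F 0).2.
  case: x => -[[[p0 [[[[[p1 p2] p3] p4] p5] p6]] [[[[[v1 v2] v3] v4] v5] v6]] p7].
  move=> [[[q0 [[[[[q1 q2] q3] q4] q5] q6]] [[[[[w1 w2] w3] w4] w5] w6]] q7].
  move=> /(Emap_kernel_deg1 n2 n21)[[-> -> -> -> [-> ->]] [-> -> q3E -> [-> ->]] _].
  have -> : q3 = p1 by apply: (mulfI n2).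
  case: y => P Q; alg_intro a; alg_intro P; alg_intro Q.
  by rewrite /eta /aug /=; ring.
pose e (x : Kmod F 0) : resf F := eta (Kval F 0 x).
have elin : linear e.
  by move=> a x y; rewrite /e linearP eta_lin ?Kval_Emap.
pose E : {linear Kmod F 0 -> resf F} :=
  HB.pack e (GRing.isLinear.Build A (Kmod F 0) (resf F) *:%R e elin).
exists (fun=> E), (fun=> c); split=> [[] []|_ b].
  by rewrite -[E c]/(eta (Kval F 0 c)) cE /eta /=; ring.
apply: (@Kval_inj F 0); rewrite linearZ_LR linear0 cE uvarE /gamma.
have -> : (0 : pair2) = (alg_zero F, alg_zero F) by [].
pose u : A := (0, ucoord F b, vzero F, 0).
transitivity ((alg_mul u (alg_zero F),
  alg_mul u (0, vzero F, (0, 0, 1, 0, 0, 0), 0)) : A * A); first by [].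
rewrite {}/u /alg_zero /vzero.
by case: b; rewrite /ucoord; congr pair; repeat congr pair; rewrite /=; ring.
Qed.

Lemma split_socle_Mmod : split_socle (Mmod F).
Proof.
(* A degree 1 coordinate that neither the image of [Dmap 2] nor multiples of x5 and x6 can reach. *)
pose q3 (x : pair2) : F := (deg1 (x.2 : A)).1.1.1.2.
(* The extra degree 1 element of the kernel of [Dmap 1], normalized by [q3 = 1]. Multiples of [s] by
   [max_ideal] are still killed by [Dmap 1] and live in degrees 2 and 3, hence lie in the image of
   [Dmap 2] by [Dmap_image_deg2]. *)
pose s : pair2 := ((0, (2, 0, -1, 1, -1, 0), vzero F, 0) : A,
  (0, (0, 0, 1, 0, 0, 0), vzero F, 0) : A).
have q3lin a (x y : pair2) : q3 (scal a *: x + y) = a * q3 x + q3 y.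
  case: x y => [P Q] [P' Q']; alg_intro P; alg_intro Q; alg_intro P'; alg_intro Q'.
  by rewrite /q3 /deg1 /=; ring.
have q30 : q3 0 = 0 by [].
pose g (z : Mmod F) : F := q3 (repr z).
have gE x : g (Mpi F x) = q3 x.
  have /quotmod_eqP/lin_imageP[y yE] : Mpi F (repr (Mpi F x)) = Mpi F x.
    exact: reprK.
  rewrite /g -[repr _](subrK x) -yE -[Dmap 2 y]scale1r -scal1 q3lin mul1r.
  case: y {yE} => P Q; alg_intro P; alg_intro Q; rewrite DmapE.
  by rewrite /q3 /deg1 /= add0r.
exists (Mpi F s), g; split.
- move=> a a0; rewrite -linearZ; apply/Mpi_exact; rewrite expr1.
  move: a a0 => [[[a0 [[[[[a1 a2] a3] a4] a5] a6]] [[[[[b1 b2] b3] b4] b5] b6]] a7].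
  rewrite {1}/aug /= => ->.
  rewrite -[X in exists x, _ = X]/(((_ : A) * s.1, _ * s.2) : A * A) !mulE /s.
  have n21 : (2 : F) != 1 := (pow2_neq F 0).2.
  pose C1 := cubic_polar (a1, a2, a3, a4, a5, a6) (2, 0, -1, 1, -1, 0).
  pose C2 := cubic_polar (a1, a2, a3, a4, a5, a6) (0, 0, 1, 0, 0, 0).
  have [||x xE] := @Dmap_image_deg2 F 2 C1.1.1.1.1.1 C1.1.1.1.1.2 C1.1.1.1.2
    C1.1.1.2 C1.1.2 C1.2 (2 * b1 - b3 + b4 - b5)
    C2.1.1.1.1.1 C2.1.1.1.1.2 C2.1.1.1.2 C2.1.1.2 C2.1.2 C2.2 b3 n21.
  - by rewrite /C1 /C2 /=; field.
  - by rewrite /C1 /C2 /=; ring.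
  exists x; rewrite xE /C1 /C2 /alg_mul /vzero /vadd /vscale /dot /=.
  by congr pair; repeat congr pair; ring.
- move=> a x y; have [u <-] := Mpi_surj x; have [v <-] := Mpi_surj y.
  by rewrite -linearP !gE q3lin.
- move=> b x; have [u <-] := Mpi_surj x; rewrite -linearZ gE uvarE.
  case: u => P Q; alg_intro P; alg_intro Q.
  by case: b; rewrite /q3 /deg1 /=; ring.
- by rewrite gE.
Qed.

End Conclusion.

Theorem mainTheorem1 :
  exists (R : comNzRingType) (m : submodClosed R^o),
    [/\ gorenstein_local m,
        ideal_pow [set` m] 4 = [set 0] &
        codim m = 6%:Z] /\
    [/\ exists M : lmodType R,
          [/\ fin_gen M, constant_seq (betti m M)
            & exponential_growth (bass m M)],
        exists M : lmodType R,
          [/\ fin_gen M, exponential_growth (betti m M)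
            & constant_seq (bass m M)] &
        exists M N : lmodType R,
          [/\ fin_gen M, fin_gen N,
              forall i : nat, (0 < i)%N -> zero_module (ext i M N)
            & forall i : nat, (0 < i)%N -> ~ zero_module (ext i N M)]].
Proof.
exists (alg rat), (max_ideal rat); split; first split.
- exact: alg_gorenstein.
- exact: max_ideal_pow4.
- exact: alg_codim.
have K_fin_gen : fin_gen (Kmod rat 0) by apply/fin_gen_submod/pair2_fin_gen.
split.
- exists (Mmod rat); split; first exact: Mmod_fin_gen.
    by exists 2%N => i; apply: betti_Mmod.
  apply: ext_exponential_growth; first exact: residue_fin_gen.
  + exact: Mmod_fin_gen.
  + exact: split_family_residue.
  + exact: split_socle_Mmod.
- exists (Kmod rat 0); split=> //.
    apply: ext_exponential_growth => //; first exact: residue_fin_gen.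
      exact: split_family_Kmod.
    exact: split_socle_residue.
  by exists 2%N => i; apply: num_gens_rank; apply: ext_Kmod_rank.
- exists (Mmod rat), (Nmod rat); split; first exact: Mmod_fin_gen.
  + exact: Nmod_fin_gen.
  + by case=> // i _; apply: ext_Mmod_Nmod.
  + case=> // i _; apply: ext_nonzero; first exact: split_family_Nmod.
    exact: split_socle_Mmod.
Qed.
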